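(* There exist problem-independent constants $C_1,C_2,C_3,C_M,C_\nu,C_s>0$ such that the following holds. Let $r\le d\le n$ be positive integers. Suppose that $\epsilon,\delta\in(0,C_3)$, $m,s\in\mathbb{N}^+$ and $E>0$ satisfy $$1\le s\le C_sC_2^{-1}\epsilon^{-1}[4r+\log(1/\delta)],$$ $$C_M\le E\le C_2^2\epsilon^2 s\,[4r+\log(1/\delta)]^{-1}e^{C_s(C_2\epsilon s)^{-1}[4r+\log(1/\delta)]},$$ $$m\ge\max\left\{E\,C_2^{-2}\epsilon^{-2}[4r+\log(1/\delta)],\ s\,e\right\}.$$ Then for any matrix $A\in\mathbb{R}^{n\times d}$ with rank $r$ and $\mu(A)\le\sqrt{s}\,C_\nu C_1^{-1}\bar\mu(\epsilon,\delta)$, where $$\bar\mu(\epsilon,\delta)=C_1\sqrt{C_2}\sqrt{\epsilon}\,\min\left\{\frac{\log(E/(C_2\epsilon))}{4r+\log(1/\delta)},\ \sqrt{\frac{\log E}{4r+\log(1/\delta)}}\right\},$$ a randomly generated $s$-hashing matrix $S\in\mathbb{R}^{m\times n}$ is an $\epsilon$-subspace embedding for $A$ with probability at least $1-\delta$.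
   Context: Coherence: if $A=U\Sigma V^T$ is the compact SVD of a rank-$r$ matrix $A\in\mathbb{R}^{n\times d}$ ($U\in\mathbb{R}^{n\times r}$ with orthonormal columns), then $\mu(A)=\max_{1\le i\le n}\|U_i\|_2$, where $U_i$ is the $i$-th row of $U$. $s$-hashing matrix: a random matrix $S\in\mathbb{R}^{m\times n}$ such that, independently for each column $j\in\{1,\dots,n\}$, indices $i_1,\dots,i_s\in\{1,\dots,m\}$ are sampled uniformly at random without replacement and $S_{i_kj}=\pm1/\sqrt{s}$ (independent signs, equal probability) for $k=1,\dots,s$; all other entries are zero. $\epsilon$-subspace embedding: $S$ is an $\epsilon$-subspace embedding for $A$ if $(1-\epsilon)\|Ax\|_2^2\le\|SAx\|_2^2\le(1+\epsilon)\|Ax\|_2^2$ for all $x\in\mathbb{R}^d$. In the condition on $m$, $e$ is Euler's number. *)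

(* Defs.v *)
From HB Require Import structures.
From mathcomp Require Import all_boot all_order all_algebra.
From mathcomp Require Import all_classical all_reals all_analysis.

Set Implicit Arguments.
Unset Strict Implicit.
Unset Printing Implicit Defensive.
Import Order.TTheory GRing.Theory Num.Theory.
Import numFieldNormedType.Exports.
Local Open Scope classical_set_scope.
Local Open Scope ring_scope.

(* The library norm on matrices is the sup norm, hence this definition. It is
   used on columns and on rows. *)
Definition l2norm (R : realType) (p q : nat) (x : 'M[R]_(p, q)) : R :=
  Num.sqrt (\sum_i \sum_j x i j ^+ 2).

(* [sigma] is the diagonal of Sigma; the singular values are not required to be
   sorted. *)
Definition compact_svd (R : realType) (n d r : nat) (A : 'M[R]_(n, d))
    (U : 'M[R]_(n, r)) (sigma : 'rV[R]_r) (V : 'M[R]_(d, r)) : Prop :=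
  [/\ U^T *m U = 1%:M,
      V^T *m V = 1%:M,
      forall k, 0 < sigma 0 k &
      A = U *m diag_mx sigma *m V^T].

(* All compact SVDs of A give the same maximal row norm, since U U^T is the
   orthogonal projector onto the column space of A; [xget] selects this value. *)
Definition coherence (R : realType) (n d : nat) (A : 'M[R]_(n, d)) : R :=
  xget 0 [set c : R | exists (U : 'M[R]_(n, \rank A)) (sigma : 'rV[R]_(\rank A))
                             (V : 'M[R]_(d, \rank A)),
            compact_svd A U sigma V /\
            c = \big[Num.max/0]_(i < n) l2norm (row i U)].

Definition subspace_embedding (R : realType) (m n d : nat) (eps : R)
    (S : 'M[R]_(m, n)) (A : 'M[R]_(n, d)) : Prop :=
  forall x : 'cV[R]_d,
    (1 - eps) * l2norm (A *m x) ^+ 2 <= l2norm (S *m A *m x) ^+ 2 /\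
    l2norm (S *m A *m x) ^+ 2 <= (1 + eps) * l2norm (A *m x) ^+ 2.

(* For each of the n columns: an ordered sample of s distinct row indices (a
   draw without replacement) and s signs. The uniform distribution on this
   finite product makes the columns, the index draws and the signs independent
   and uniform. *)
Definition hashing_sample (m n s : nat) : finType :=
  {ffun 'I_n -> {f : {ffun 'I_s -> 'I_m} | injectiveb f} *
                {ffun 'I_s -> bool}}.

(* At most one k contributes to each entry, because the indices are distinct. *)
Definition hashing_mx (R : realType) (m n s : nat) (w : hashing_sample m n s) :
    'M[R]_(m, n) :=
  \matrix_(i, j) \sum_(k < s | val (w j).1 k == i)
    (-1) ^+ ((w j).2 k) / Num.sqrt s%:R.

(* S is a random matrix on (T, P) whose distribution is that of [hashing_mx] of
   a uniformly distributed sample. *)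
Definition s_hashing (R : realType) (dT : measure_display)
    (T : measurableType dT) (P : probability T R) (m n s : nat)
    (S : T -> 'M[R]_(m, n)) : Prop :=
  (forall i j, measurable_fun setT (fun t => S t i j)) /\
  (forall M : 'M[R]_(m, n),
     P [set t | S t = M] =
     ((#|[set w : hashing_sample m n s | hashing_mx R w == M]%SET|%:R
       / #|hashing_sample m n s|%:R)%:E)%E).

Definition log_dim (R : realType) (r : nat) (delta : R) : R :=
  4 * r%:R + ln (1 / delta).

Definition mu_bar (R : realType) (C1 C2 E : R) (r : nat) (eps delta : R) : R :=
  C1 * Num.sqrt C2 * Num.sqrt eps *
  Num.min (ln (E / (C2 * eps)) / log_dim r delta)
          (Num.sqrt (ln E / log_dim r delta)).

(* Main.v *)
(* Write [mu <= nu] for the coherence and [L = 4 r + log (1 / delta)].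

   For a fixed vector [x] in the column space of [A] with [|x| <= 1], the
   coordinates of [x] are at most [nu], and [s (|S x|^2 - |x|^2)] is a sum over
   the rows of [S] of an off-diagonal quadratic form in the entries of the row.
   Expanding a [p]-th power, every monomial in the entries has an expectation
   bounded by that of independent entries which are nonzero with probability
   [q = s / m]: odd exponents give zero, and sampling without replacement is
   negatively correlated. For independent rows the [p]-th moment is at most
   [p! / t^p] times the [m]-th power of a row generating function, truncated at
   order [p]. A row monomial with a nonzero expectation has a support of some size
   [h] with [2 <= h <= p], which yields
     [1 + sum_(2 <= h <= p) (e^2 t / m)^h T_p(a h^2)], where [a = t nu^2 / s]
   and [T_p] is the truncated exponential. Since [T_p(y) <= exp(sqrt(2 p y))],
   truncation turns the Gaussian growth in [h] into a geometric one, and the two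
   bounds on [nu] make the series at most [p / m] for [t] of order [p / eps].
   Markov's inequality with [p] of order [L] then gives failure probability
   [exp (- p)].

   A union bound over a grid net of [2^(27 r)] points of the unit ball finishes
   the proof. The coherence
   is the one of an actual compact SVD, whose existence comes from maximizing
   [|A v|] on the unit sphere and deflating; the embedding event is measurable
   because it suffices to test integer vectors. *)
Require Import Defs.
From mathcomp Require Import all_boot all_order all_algebra.
From mathcomp Require Import all_classical all_reals all_analysis.
From mathcomp Require Import perm measurable_realfun zify ring lra.
Set Implicit Arguments.
Unset Strict Implicit.
Unset Printing Implicit Defensive.
Import Order.TTheory GRing.Theory Num.Theory.
Import numFieldNormedType.Exports.
Local Open Scope classical_set_scope.
Local Open Scope ring_scope.

(** * Counting the injections whose image contains a given set *)

Section InjectionCovering.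
Variables m s : nat.

Definition injection := {f : {ffun 'I_s -> 'I_m} | injectiveb f}.

Definition inj_image (f : injection) : {set 'I_m} := [set val f k | k : 'I_s]%SET.

Definition covering (H : {set 'I_m}) : nat :=
  #|[set f : injection | H \subset inj_image f]%SET|.

Lemma inj_ffun_inj (f : injection) : injective (val f).
Proof. by apply/injectiveP; apply: (valP f). Qed.

Lemma card_inj_image (f : injection) : #|inj_image f| = s.
Proof. by rewrite card_imset ?card_ord //; apply: inj_ffun_inj. Qed.

Lemma permute_injection_proof (t : {perm 'I_m}) (f : injection) :
  injectiveb [ffun k => t (val f k)].
Proof.
by apply/injectiveP => k l; rewrite !ffunE => /perm_inj/inj_ffun_inj.
Qed.

Definition permute_injection (t : {perm 'I_m}) (f : injection) : injection :=
  exist _ [ffun k => t (val f k)] (permute_injection_proof t f).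

Lemma inj_image_permute (t : {perm 'I_m}) (f : injection) :
  inj_image (permute_injection t f) = (t @: inj_image f)%SET.
Proof.
rewrite /inj_image -imset_comp.
by apply: eq_imset => k; rewrite /= ffunE.
Qed.

Lemma permute_injection_inj (t : {perm 'I_m}) : injective (permute_injection t).
Proof.
move=> f g /(congr1 val)/ffunP e; apply/val_inj/ffunP => k.
by have := e k; rewrite !ffunE => /perm_inj.
Qed.

Lemma covering_permute (t : {perm 'I_m}) (H : {set 'I_m}) :
  (covering H <= covering (t @: H)%SET)%N.
Proof.
rewrite /covering -(card_imset _ (@permute_injection_inj t)).
apply/subset_leq_card/fintype.subsetP => x /imsetP[f]; rewrite !inE => Hf ->.
by rewrite inj_image_permute imsetS.
Qed.

(** Double counting of the pairs of a [j] outside [H] and an [f] whose image contains [j] and [H]: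
    by symmetry all [j] have equally many [f], and each [f] covering [H] leaves [s - #|H|] choices
    of [j]. *)
Lemma covering_setU1 (H : {set 'I_m}) (i : 'I_m) : i \notin H ->
  ((m - #|H|) * covering (i |: H)%SET = (s - #|H|) * covering H)%N.
Proof.
move=> iH.
have sym j : j \notin H -> covering (j |: H)%SET = covering (i |: H)%SET.
  move=> jH.
  have tH k l : k \notin H -> l \notin H ->
      (tperm k l @: (k |: H))%SET = (l |: H)%SET.
    move=> kH lH; rewrite imsetU1 tpermL; congr (_ |: _).
    rewrite -[RHS]imset_id; apply: eq_in_imset => z zH.
    by rewrite tpermD //; apply: contraNneq kH => -> || apply: contraNneq lH => ->.
  by apply/eqP; rewrite eqn_leq -{1}(tH j i) // covering_permute
    -{1}(tH i j) // covering_permute.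
have -> : (m - #|H|)%N = #|~: H| by have := cardsC H; rewrite card_ord; lia.
rewrite -sum_nat_const.
rewrite (eq_bigr (fun j => covering (j |: H)%SET)); last first.
  by move=> j; rewrite inE => jH; rewrite sym.
rewrite /covering.
under eq_bigr do rewrite -sum1_card big_mkcond.
rewrite exchange_big /= [RHS]mulnC -sum_nat_const [RHS]big_mkcond /=.
apply: eq_bigr => f _; rewrite inE.
have -> : (\sum_(j in ~: H) (if f \in [set f0 | (j |: H)%SET \subset inj_image f0]%SET
    then 1 else 0) = \sum_(j in ~: H)
      (if (j \in inj_image f) && (H \subset inj_image f) then 1 else 0))%N.
  by apply: eq_bigr => j _; rewrite inE finset.subUset finset.sub1set.
case: ifP => Hf; last by rewrite big1 // => j _; rewrite andbF.
rewrite -big_mkcondr /= sum1_card -(card_inj_image f).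
have := cardsD (inj_image f) H; rewrite (finset.setIidPr Hf) => <-.
by apply: eq_card => j; rewrite !inE unfold_in /= !inE andbT.
Qed.

(** Negative correlation of sampling without replacement: by [covering_setU1] each further index
    costs a factor [(s - h) / (m - h)], at most [s / m]. *)
Lemma covering_bound (H : {set 'I_m}) : (s <= m)%N ->
  (m ^ #|H| * covering H <= s ^ #|H| * #|{: injection}|)%N.
Proof.
move=> sm; have [k] := ubnP #|H|; elim: k H => // k IH H.
have [->|[i iH]] := finset.set_0Vmem H.
  by rewrite cards0 !expn0 !mul1n max_card.
rewrite (cardsD1 i H) iH add1n ltnS => Hk.
have := covering_setU1 (H := (H :\ i)%SET) (i := i).
rewrite finset.setD11 finset.setD1K // => /(_ isT) e.
have {IH} := IH (H :\ i)%SET Hk.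
have : (#|H :\ i| < m)%N.
  have := max_card (mem H); rewrite card_ord (cardsD1 i H) iH; lia.
move: e; set h := #|_|; set c := covering H; set c' := covering _ => e hm IH.
have cc : (m * c <= s * c')%N.
    rewrite -(leq_pmul2l (m := (m - h)%N)) ?subn_gt0 // mulnCA e.
    by rewrite mulnA [leqRHS]mulnA leq_mul2r; apply/orP; right; nia.
rewrite !expnS -mulnA mulnCA (leq_trans (leq_mul (leqnn _) cc)) //.
by rewrite mulnCA -mulnA leq_mul.
Qed.

End InjectionCovering.

(** * Mixed moments of the entries of one hashing column *)

Section ColumnMoments.
Variables (R : realType) (m s : nat).
Hypothesis s_le_m : (s <= m)%N.
Hypothesis m_gt0 : (0 < m)%N.

Definition hash_column : finType :=
  (injection m s * {ffun 'I_s -> bool})%type.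

(* The column without its normalization [1 / sqrt s]. *)
Definition col_entry (c : hash_column) (i : 'I_m) : R :=
  \sum_(k < s | val c.1 k == i) (-1) ^+ (c.2 k).

(* The [a]-th moment of a sign that is switched on with probability [q]. *)
Definition sign_moment (q : R) (a : nat) : R :=
  if a == 0%N then 1 else if odd a then 0 else q.

Lemma sign_moment_ge0 (q : R) (a : nat) : 0 <= q -> 0 <= sign_moment q a.
Proof. by rewrite /sign_moment; case: ifP => // _; case: ifP. Qed.

Lemma col_entry_image (c : hash_column) (k : 'I_s) :
  col_entry c (val c.1 k) = (-1) ^+ (c.2 k).
Proof.
rewrite /col_entry (big_pred1 k) // => l /=.
by apply/eqP/eqP => [/inj_ffun_inj|->].
Qed.

Lemma col_entry_notin (c : hash_column) (i : 'I_m) :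
  i \notin inj_image c.1 -> col_entry c i = 0.
Proof.
move=> ni; rewrite /col_entry big_pred0 // => k; apply: contraNF ni => /eqP <-.
exact: imset_f.
Qed.

Lemma col_entry_sqr_sum (c : hash_column) : \sum_i col_entry c i ^+ 2 = s%:R.
Proof.
rewrite (bigID (mem (inj_image c.1))) /= [X in _ + X]big1 ?addr0; last first.
  by move=> i /col_entry_notin ->; rewrite expr0n.
rewrite /inj_image big_imset /=; last by move=> k l _ _; apply: inj_ffun_inj.
rewrite (eq_bigr (fun=> 1)) ?sumr_const ?card_ord // => k _.
by rewrite col_entry_image sqrr_sign.
Qed.

Definition flip_sign (i0 : 'I_m) (c : hash_column) : hash_column :=
  (c.1, [ffun k => c.2 k (+) (val c.1 k == i0)]).

Lemma flip_signK (i0 : 'I_m) : involutive (flip_sign i0).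
Proof.
move=> [f e]; rewrite /flip_sign /=; congr pair; apply/ffunP => k.
by rewrite !ffunE /= -addbA addbb addbF.
Qed.

Lemma col_entry_flip (i0 : 'I_m) (c : hash_column) (i : 'I_m) :
  col_entry (flip_sign i0 c) i = (-1) ^+ (i == i0) * col_entry c i.
Proof.
rewrite /col_entry mulr_sumr; apply: eq_bigr => k /eqP <-.
by rewrite ffunE signr_addb mulrC.
Qed.

(** Flipping the sign at [i0] is an involution of the samples that negates the monomial. *)
Lemma col_moment_odd (al : 'I_m -> nat) (i0 : 'I_m) : odd (al i0) ->
  \sum_(c : hash_column) \prod_i col_entry c i ^+ al i = 0.
Proof.
move=> oi; set S := \sum_c _; suff: S = - S by lra.
rewrite /S {1}(reindex_inj (inv_inj (flip_signK i0))) /= -sumrN.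
apply: eq_bigr => c _.
rewrite (bigD1 i0) //= [in RHS](bigD1 i0) //= col_entry_flip eqxx exprMn.
rewrite expr1 -signr_odd oi expr1 !mulN1r mulNr; congr (- (_ * _)).
apply: eq_bigr => i ni; by rewrite col_entry_flip (negPf ni) mul1r.
Qed.

(** Without odd exponents the monomial is at most the indicator that the sampled rows contain its
    support [H], whose frequency [covering_bound] controls. *)
Lemma col_moment (al : 'I_m -> nat) :
  `|\sum_(c : hash_column) \prod_i col_entry c i ^+ al i|
  <= #|hash_column|%:R * \prod_i sign_moment (s%:R / m%:R) (al i).
Proof.
have q0 : 0 <= s%:R / m%:R :> R by rewrite divr_ge0.
have [/existsP[i oi]|/existsPn ev] := boolP [exists i, odd (al i)].
  rewrite (col_moment_odd oi) normr0 mulr_ge0 // prodr_ge0 // => i' _.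
  exact: sign_moment_ge0.
pose H := [set i | al i != 0%N]%SET.
have -> : \prod_i sign_moment (s%:R / m%:R) (al i) = (s%:R / m%:R) ^+ #|H|.
  rewrite -prodr_const [RHS]big_mkcond; apply: eq_bigr => i _.
  by rewrite /sign_moment inE (negPf (ev i)); case: ifP.
have bound c : `|\prod_i col_entry c i ^+ al i| <= (H \subset inj_image c.1)%:R.
  rewrite normr_prod.
  have [HI|/fintype.subsetPn[i iH ni]] := boolP (_ \subset _).
    apply: prodr_ile1 => i _; rewrite normr_ge0 /= normrX.
    have [/imsetP[k _ ->]|ni] := boolP (i \in inj_image c.1).
      by rewrite col_entry_image normrX normrN1 !expr1n.
    have : i \notin H by apply: contra ni; apply/fintype.subsetP.
    by rewrite inE negbK => /eqP ->; rewrite expr0.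
  move: iH; rewrite inE => iH.
  by rewrite (bigD1 i) //= col_entry_notin // expr0n (negPf iH) normr0 mul0r.
apply: le_trans (ler_norm_sum _ _ _) _.
apply: le_trans (ler_sum _ (fun c _ => bound c)) _.
rewrite -natr_sum.
have -> : (\sum_(c : hash_column) (H \subset inj_image c.1) =
           covering s H * 2 ^ s)%N.
  rewrite -(pair_bigA _ (fun f (_ : {ffun 'I_s -> bool}) =>
    nat_of_bool (H \subset inj_image f))) /=.
  under eq_bigr do rewrite sum_nat_const card_ffun card_bool card_ord.
  rewrite -big_distrr /= mulnC; congr (_ * _)%N.
  by rewrite /covering -sum1_card [RHS]big_mkcond /=; apply: eq_bigr => f _; rewrite inE; case: ifP.
rewrite /hash_column card_prod card_ffun card_bool card_ord expr_div_n.
rewrite mulrA ler_pdivlMr ?exprn_gt0 ?ltr0n // -!natrX -!natrM ler_nat.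
rewrite mulnAC [leqRHS]mulnAC leq_mul2r; apply/orP; right.
rewrite mulnC [leqRHS]mulnC; exact: covering_bound.
Qed.

End ColumnMoments.

(** * Independent signed entries and the expansion of powers into monomials *)

Section IndependentModel.
Variable R : realType.

Lemma prod_fibers (T I : finType) (g : T -> I) (F : I -> R) :
  \prod_t F (g t) = \prod_i F i ^+ #|[set t | g t == i]%SET|.
Proof.
rewrite (partition_big g predT) //=; apply: eq_bigr => i _.
rewrite -prodr_const; apply: eq_big => t; first by rewrite inE.
by move/eqP->.
Qed.

Lemma sum_prod_weight (I W : finType) (wt : W -> R) (F : I -> W -> R) :
  \sum_(a : {ffun I -> W}) (\prod_i wt (a i)) * \prod_i F i (a i)
  = \prod_i \sum_x wt x * F i x.
Proof. by rewrite bigA_distr_bigA; apply: eq_bigr => a _; rewrite big_split. Qed.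

(** The [2 p] factors of a monomial are indexed by ['I_p * bool], so that exponents become cardinals
    of fibers, as in [prod_fibers]. *)
Lemma exp_sum_pairs (Th I : finType) (c : Th -> R) (g : Th -> bool -> I)
    (F : I -> R) (p : nat) :
  (\sum_th c th * (F (g th false) * F (g th true))) ^+ p
  = \sum_(f : {ffun 'I_p -> Th})
      (\prod_k c (f k)) * \prod_(t : 'I_p * bool) F (g (f t.1) t.2).
Proof.
rewrite -[p in LHS]card_ord -prodr_const bigA_distr_bigA.
apply: eq_bigr => f _; rewrite big_split; congr (_ * _).
rewrite -(pair_bigA _ (fun k b => F (g (f k) b))) /=.
by apply: eq_bigr => k _; rewrite big_bool mulrC.
Qed.

(* First component: whether the entry is switched on; second one: its sign. *)
Definition sign_weight (q : R) (o : bool * bool) : R :=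
  (if o.1 then q else 1 - q) / 2.

Definition sign_value (o : bool * bool) : R := if o.1 then (-1) ^+ o.2 else 0.

Lemma sign_weight_sum (q : R) (a : nat) :
  \sum_o sign_weight q o * sign_value o ^+ a = sign_moment q a.
Proof.
rewrite -(pair_bigA _ (fun b e => sign_weight q (b, e) * sign_value (b, e) ^+ a)).
rewrite /= !big_bool /= /sign_weight /sign_value /= expr0 expr1 expr1n.
rewrite /sign_moment expr0n -signr_odd.
by case: eqP => [->|_] /=; last case: odd => /=; rewrite ?expr0 ?expr1; field.
Qed.

Lemma sign_model_moment (I : finType) (q : R) (al : I -> nat) :
  \sum_(a : {ffun I -> bool * bool})
    (\prod_i sign_weight q (a i)) * \prod_i sign_value (a i) ^+ al i
  = \prod_i sign_moment q (al i).
Proof.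
rewrite (sum_prod_weight (sign_weight q) (fun i o => sign_value o ^+ al i)).
by apply: eq_bigr => i _; rewrite sign_weight_sum.
Qed.

Definition row_weight (n : nat) (q : R) (a : {ffun 'I_n -> bool * bool}) : R :=
  \prod_j sign_weight q (a j).

End IndependentModel.

(** * Comparison of the hashing entries with independent ones *)

Section Comparison.
Variables (R : realType) (m n s : nat).
Hypothesis s_le_m : (s <= m)%N.
Hypothesis m_gt0 : (0 < m)%N.

Definition entry (w : hashing_sample m n s) (ij : 'I_m * 'I_n) : R :=
  col_entry R (w ij.2) ij.1.

(** The columns are independent, so the sum factors into the column moments bounded by
    [col_moment]. *)
Lemma sample_moment (T : finType) (g : T -> 'I_m * 'I_n) :
  `|\sum_w \prod_t entry w (g t)|
  <= #|hashing_sample m n s|%:R *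
     \prod_ij sign_moment (s%:R / m%:R : R) #|[set t | g t == ij]%SET|.
Proof.
pose al j i := #|[set t | g t == (i, j)]%SET|.
have -> : \sum_w \prod_t entry w (g t) =
    \prod_(j < n) \sum_(c : hash_column m s) \prod_i col_entry R c i ^+ al j i.
  rewrite bigA_distr_bigA; apply: eq_bigr => w _; rewrite prod_fibers.
  rewrite exchange_big /= pair_bigA /=.
  by apply: eq_bigr => -[i j] _.
rewrite normr_prod.
have -> : #|hashing_sample m n s|%:R *
     \prod_ij sign_moment (s%:R / m%:R : R) #|[set t | g t == ij]%SET| =
   \prod_(j < n) (#|hash_column m s|%:R *
      \prod_i sign_moment (s%:R / m%:R : R) (al j i)).
  rewrite big_split prodr_const card_ord card_ffun card_ord natrX; congr (_ * _).
  rewrite exchange_big /= pair_bigA /=.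
  by apply: eq_bigr => -[i j] _.
by apply: ler_prod => j _; rewrite normr_ge0 col_moment.
Qed.

Lemma model_moment (q : R) (T : finType) (g : T -> 'I_m * 'I_n) :
  \sum_(a : {ffun 'I_m -> {ffun 'I_n -> bool * bool}})
    (\prod_i row_weight q (a i)) *
    \prod_t sign_value R (a (g t).1 (g t).2)
  = \prod_ij sign_moment q #|[set t | g t == ij]%SET|.
Proof.
rewrite -(pair_bigA _ (fun i j => sign_moment q #|[set t | g t == (i, j)]%SET|)).
under [RHS]eq_bigr do rewrite -sign_model_moment.
rewrite -(sum_prod_weight (row_weight q) (fun i (a : {ffun 'I_n -> bool * bool}) =>
  \prod_j sign_value R (a j) ^+ #|[set t | g t == (i, j)]%SET|)).
apply: eq_bigr => a _; congr (_ * _).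
rewrite (prod_fibers g (fun ij => sign_value R (a ij.1 ij.2))) pair_bigA /=.
by apply: eq_bigr => -[i j] _.
Qed.

(* The mixed moments of the independent model are nonnegative and dominate those
   of the hashing entries; only the signs of the coefficients are lost. *)
Lemma moment_comparison (Th : finType) (c : Th -> R)
    (g : Th -> bool -> 'I_m * 'I_n) (p : nat) :
  \sum_w (\sum_th c th * (entry w (g th false) * entry w (g th true))) ^+ p
  <= #|hashing_sample m n s|%:R *
     \sum_(a : {ffun 'I_m -> {ffun 'I_n -> bool * bool}})
       (\prod_i row_weight (s%:R / m%:R) (a i)) *
       (\sum_th `|c th| * (sign_value R (a (g th false).1 (g th false).2) *
                           sign_value R (a (g th true).1 (g th true).2))) ^+ p.
Proof.
under eq_bigr do rewrite exp_sum_pairs.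
pose wt (a : {ffun 'I_m -> {ffun 'I_n -> bool * bool}}) : R :=
  \prod_i row_weight (s%:R / m%:R) (a i).
rewrite [in leRHS](eq_bigr (fun a => \sum_(f : {ffun 'I_p -> Th})
    (\prod_k `|c (f k)|) * (wt a * \prod_(t : 'I_p * bool)
      sign_value R (a (g (f t.1) t.2).1 (g (f t.1) t.2).2)))); last first.
  move=> a _; rewrite (exp_sum_pairs (fun th => `|c th|) g
    (fun ij => sign_value R (a ij.1 ij.2))) mulr_sumr.
  by apply: eq_bigr => f _; rewrite mulrCA.
rewrite exchange_big [in leRHS]exchange_big /= mulr_sumr.
apply: ler_sum => f _; rewrite -!mulr_sumr.
rewrite (model_moment _ (fun t : 'I_p * bool => g (f t.1) t.2)).
apply: le_trans (ler_norm _) _; rewrite normrM normr_prod mulrCA.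
by rewrite ler_wpM2l ?prodr_ge0 // sample_moment.
Qed.

End Comparison.

(** * Moments of sums of independent copies *)

Section IndependentSums.
Variable R : realType.

Definition texp (p : nat) (y : R) : R := \sum_(k < p.+1) y ^+ k / k`!%:R.

Definition texp_poly (p : nat) (y : R) : {poly R} :=
  \poly_(k < p.+1) (y ^+ k / k`!%:R).

(** Degrees up to [p] do not see the truncation; there the product of exponentials is the
    exponential of the sum, by the binomial formula. *)
Lemma coef_prod_texp_poly (p : nat) (I : Type) (r : seq I) (y : I -> R) (k : nat) :
  (k <= p)%N ->
  (\prod_(i <- r) texp_poly p (y i))`_k = (\sum_(i <- r) y i) ^+ k / k`!%:R.
Proof.
elim: r k => [|i r IH] k kp.
  rewrite !big_nil coef1 expr0n.
  by case: k kp => [|k] _; rewrite /= ?fact0 ?divr1 ?mul0r.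
rewrite !big_cons coefM [in RHS]addrC exprDn mulr_suml; apply: eq_bigr => j _.
have jk : (j <= k)%N by rewrite -ltnS.
rewrite coef_poly ltnS (leq_trans jk kp) IH ?(leq_trans (leq_subr _ _) kp) //.
have fn (l : nat) : l`!%:R != 0 :> R by rewrite pnatr_eq0 -lt0n fact_gt0.
have /(congr1 (fun z : nat => z%:R : R)) := bin_fact jk; rewrite !natrM => <-.
have b0 : 'C(k, j)%:R != 0 :> R by rewrite pnatr_eq0 -lt0n bin_gt0.
rewrite -[in RHS]mulr_natr; set u := _ ^+ (k - j).
by field; rewrite b0 !fn.
Qed.

Lemma coef_le_horner1 (P : {poly R}) (k : nat) :
  (forall i, 0 <= P`_i) -> P`_k <= P.[1].
Proof.
move=> P0; rewrite horner_coef; under eq_bigr do rewrite expr1n mulr1.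
have [kP|kP] := ltnP k (size P); last by rewrite nth_default // sumr_ge0.
by rewrite (bigD1 (Ordinal kP)) //= lerDl sumr_ge0.
Qed.

Lemma coef_exp_ge0 (P : {poly R}) (l k : nat) :
  (forall i, 0 <= P`_i) -> 0 <= (P ^+ l)`_k.
Proof.
move=> P0; elim: l k => [|l IH] k; first by rewrite expr0 coef1 ler0n.
by rewrite exprS coefM sumr_ge0 // => j _; rewrite mulr_ge0.
Qed.

(* Only the moments up to order [p] of the summands enter: the generating
   function of the summands may be infinite or far too large. *)
Lemma moment_sum_iid (W : finType) (wt Y : W -> R) (m p : nat) (t : R) :
  0 <= t ->
  (forall k, 0 <= \sum_x wt x * Y x ^+ k) ->
  t ^+ p * \sum_(a : {ffun 'I_m -> W}) (\prod_i wt (a i)) * (\sum_i Y (a i)) ^+ p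
  <= p`!%:R * (\sum_(k < p.+1) t ^+ k / k`!%:R * \sum_x wt x * Y x ^+ k) ^+ m.
Proof.
move=> t0 mu0.
have fp : 0 < p`!%:R :> R by rewrite ltr0n fact_gt0.
rewrite -ler_pdivrMl // mulrA.
pose Q := \poly_(k < p.+1) (t ^+ k / k`!%:R * \sum_x wt x * Y x ^+ k).
have Q0 i : 0 <= Q`_i.
  rewrite coef_poly; case: ifP => // _.
  by rewrite mulr_ge0 // divr_ge0 // exprn_ge0.
have QE : \sum_x (wt x)%:P * texp_poly p (t * Y x) = Q.
  apply/polyP => k; rewrite coef_sum coef_poly.
  under eq_bigr do rewrite coefCM coef_poly.
  case: ltnP => _; last by rewrite big1 // => x _; rewrite mulr0.
  rewrite mulr_sumr; apply: eq_bigr => x _; rewrite exprMn; ring.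
(* By independence the normalized moment is a coefficient of a power of the averaged polynomial
   [Q]. *)
have -> : (p`!%:R)^-1 * t ^+ p *
    (\sum_(a : {ffun 'I_m -> W}) (\prod_i wt (a i)) * (\sum_i Y (a i)) ^+ p)
    = (Q ^+ m)`_p.
  rewrite -[m in RHS]card_ord -prodr_const -QE bigA_distr_bigA coef_sum mulr_sumr.
  apply: eq_bigr => a _.
  rewrite big_split /= -rmorph_prod coefCM coef_prod_texp_poly //.
  by rewrite -mulr_sumr exprMn; ring.
(* The coefficients are nonnegative, so each is at most the value at 1. *)
apply: le_trans (coef_le_horner1 _ _) _; first by move=> i; apply: coef_exp_ge0.
rewrite horner_exp horner_poly.
by under eq_bigr do rewrite expr1n mulr1.
Qed.

End IndependentSums.

(** * Moments of the off-diagonal quadratic form of one row *)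

Section RowMoments.
Variables (R : realType) (n : nat).

Definition offdiag (x : 'I_n -> R) (jj : 'I_n * 'I_n) : R :=
  if jj.1 == jj.2 then 0 else x jj.1 * x jj.2.

(** The coefficients carry absolute values because [moment_comparison] loses their signs. *)
Definition row_form (x : 'I_n -> R) (a : {ffun 'I_n -> bool * bool}) : R :=
  \sum_jj `|offdiag x jj| * (sign_value R (a jj.1) * sign_value R (a jj.2)).

Definition row_moment (q : R) (x : 'I_n -> R) (k : nat) : R :=
  \sum_a row_weight q a * row_form x a ^+ k.

Let side (jj : 'I_n * 'I_n) (b : bool) : 'I_n := if b then jj.2 else jj.1.

(** The exponent of the entry [j] in the monomial chosen by [f]. *)
Let mult (k : nat) (f : {ffun 'I_k -> 'I_n * 'I_n}) (j : 'I_n) : nat :=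
  #|[set t : 'I_k * bool | side (f t.1) t.2 == j]%SET|.

Lemma row_moment_expand (q : R) (x : 'I_n -> R) (k : nat) :
  row_moment q x k =
  \sum_(f : {ffun 'I_k -> 'I_n * 'I_n})
    (\prod_l `|offdiag x (f l)|) * \prod_j sign_moment q (mult f j).
Proof.
rewrite /row_moment.
under eq_bigr => a _ do rewrite /row_form
  (exp_sum_pairs (fun jj => `|offdiag x jj|) side (fun j => sign_value R (a j))) mulr_sumr.
rewrite exchange_big; apply: eq_bigr => f _ /=.
rewrite -sign_model_moment mulr_sumr; apply: eq_bigr => a _.
by rewrite (prod_fibers (fun t : 'I_k * bool => side (f t.1) t.2)
  (fun j => sign_value R (a j))) mulrCA.
Qed.

Lemma row_moment_ge0 (q : R) (x : 'I_n -> R) (k : nat) :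
  0 <= q -> 0 <= row_moment q x k.
Proof.
move=> q0; rewrite row_moment_expand sumr_ge0 // => f _.
by rewrite mulr_ge0 ?prodr_ge0 // => j _; apply: sign_moment_ge0.
Qed.

Lemma row_moment0 (q : R) (x : 'I_n -> R) : row_moment q x 0 = 1.
Proof.
transitivity (\prod_(j < n) sign_moment q 0); last by rewrite big1.
rewrite -(sign_model_moment q (fun=> 0%N)); apply: eq_bigr => a _.
by congr (_ * _); rewrite big1 // => j _; rewrite expr0.
Qed.

Lemma sum_mult (k : nat) (f : {ffun 'I_k -> 'I_n * 'I_n}) :
  (\sum_j mult f j = k * 2)%N.
Proof.
rewrite -[k in RHS]card_ord -card_bool -card_prod -sum1_card.
rewrite (partition_big (fun t : 'I_k * bool => side (f t.1) t.2) predT) //=.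
apply: eq_bigr => j _; rewrite /mult -sum1_card.
by apply: eq_bigl => t; rewrite inE.
Qed.

(* Each index that occurs in a contributing monomial occurs an even number of
   times, hence twice with [x_j ^ 2], and further with at most [nu] each. *)
Lemma monomial_bound (q nu : R) (x : 'I_n -> R) (k : nat)
    (f : {ffun 'I_k -> 'I_n * 'I_n}) :
  0 <= q -> (forall j, `|x j| <= nu) -> (0 < k)%N ->
  (\prod_l `|offdiag x (f l)|) * \prod_j sign_moment q (mult f j) <=
  \sum_(H : {set 'I_n} | (1 < #|H| <= k)%N)
    (f \in ffun_on (finset.setX H H))%:R *
    (q ^+ #|H| * (nu ^+ 2) ^+ (k - #|H|) * \prod_(j in H) x j ^+ 2).
Proof.
move=> q0 xnu k0.
have rhs0 (H : {set 'I_n}) : 0 <= (f \in ffun_on (finset.setX H H))%:R *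
    (q ^+ #|H| * (nu ^+ 2) ^+ (k - #|H|) * \prod_(j in H) x j ^+ 2).
  rewrite mulr_ge0 ?ler0n // mulr_ge0 ?prodr_ge0 // => [|j _]; last exact: sqr_ge0.
  by apply: mulr_ge0; apply: exprn_ge0 => //; apply: sqr_ge0.
have [/existsP[j oj]|/existsPn ev] := boolP [exists j, odd (mult f j)].
  rewrite [X in _ * X](bigD1 j) //= {1}/sign_moment oj.
  by case: eqP oj => [->//|_ _]; rewrite mul0r mulr0 sumr_ge0.
have [/existsP[l dl]|/existsPn nd] := boolP [exists l, (f l).1 == (f l).2].
  by rewrite (bigD1 l) //= {1}/offdiag dl normr0 !mul0r sumr_ge0.
(* The support of the monomial; the term at this set alone already gives the bound. *)
pose H := [set j | mult f j != 0%N]%SET.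
have sideH l b : side (f l) b \in H.
  rewrite inE -lt0n card_gt0; apply/finset.set0Pn; exists (l, b).
  by rewrite inE.
have mult2 j : j \in H -> (2 <= mult f j)%N.
  rewrite inE => mj; have := ev j; case: (mult f j) mj => [|[|]] //.
have HE : (\sum_(j in H) mult f j = k * 2)%N.
  rewrite -(sum_mult f) [LHS]big_mkcond; apply: eq_bigr => j _.
  by rewrite inE; case: eqP.
have Hk : (#|H| <= k)%N.
  have : (\sum_(j in H) 2 <= \sum_(j in H) mult f j)%N by apply: leq_sum.
  by rewrite sum_nat_const HE leq_mul2r.
have H1 : (1 < #|H|)%N.
  have l0 := Ordinal k0; apply/card_gt1P; exists (f l0).1, (f l0).2.
  split; [exact: (sideH l0 false)|exact: (sideH l0 true)|exact: nd].
have fH : f \in ffun_on (finset.setX H H).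
  apply/ffun_onP => l; rewrite inE; apply/andP; split.
    exact: (sideH l false).
  exact: (sideH l true).
rewrite (bigD1 H) ?H1 ?Hk //= fH mul1r ler_wpDr ?sumr_ge0 //.
have -> : \prod_j sign_moment q (mult f j) = q ^+ #|H|.
  rewrite -prodr_const [RHS]big_mkcond; apply: eq_bigr => j _.
  by rewrite /sign_moment inE (negPf (ev j)); case: ifP.
rewrite mulrC -mulrA ler_wpM2l ?exprn_ge0 //.
have -> : \prod_l `|offdiag x (f l)| = \prod_(j in H) `|x j| ^+ mult f j.
  rewrite [RHS](_ : _ = \prod_j `|x j| ^+ mult f j); last first.
    rewrite [LHS]big_mkcond; apply: eq_bigr => j _; rewrite inE.
    by case: eqP => //= ->; rewrite expr0.
  rewrite -(prod_fibers (fun t : 'I_k * bool => side (f t.1) t.2) (fun j => `|x j|)).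
  rewrite -(pair_bigA _ (fun l b => `|x (side (f l) b)|)) /=.
  by apply: eq_bigr => l _; rewrite big_bool /offdiag (negPf (nd l)) normrM mulrC.
(* Removing two occurrences of each index of [H] leaves [2 k - 2 #|H|] factors. *)
have -> : (nu ^+ 2) ^+ (k - #|H|) = \prod_(j in H) nu ^+ (mult f j - 2).
  rewrite prodrXr -exprM mulnBr (mulnC 2%N k) -HE; congr (_ ^+ _).
  by rewrite mulnC -sum_nat_const sumnB.
rewrite -big_split /=; apply: ler_prod => j /mult2 mj.
rewrite exprn_ge0 //= -{1}(subnK mj) exprD real_normK ?num_real //.
by rewrite ler_wpM2r ?sqr_ge0 // lerXn2r ?nnegrE // (le_trans _ (xnu j)).
Qed.

(** For a fixed support [H] there are [#|H| ^ (2 k)] words [f] of pairs from [H], and the bound on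
    each does not depend on [f]. *)
Lemma row_moment_bound (q nu : R) (x : 'I_n -> R) (k : nat) :
  0 <= q -> (forall j, `|x j| <= nu) -> (0 < k)%N ->
  row_moment q x k <=
  \sum_(H : {set 'I_n} | (1 < #|H| <= k)%N)
    #|H|%:R ^+ (2 * k) *
    (q ^+ #|H| * (nu ^+ 2) ^+ (k - #|H|) * \prod_(j in H) x j ^+ 2).
Proof.
move=> q0 xnu k0; rewrite row_moment_expand.
apply: le_trans (ler_sum _ (fun f _ => monomial_bound f q0 xnu k0)) _.
rewrite exchange_big /=; apply: ler_sum => H _.
rewrite -mulr_suml -natr_sum.
have -> : (\sum_(f : {ffun 'I_k -> 'I_n * 'I_n}) (f \in ffun_on (finset.setX H H))
    = #|H| ^ (2 * k))%N.
  transitivity #|@ffun_on 'I_k (finset.setX H H)|.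
    by rewrite -sum1_card [RHS]big_mkcond; apply: eq_bigr => f _; case: ifP.
  by rewrite card_ffun_on cardsX card_ord expnM mulnn.
by rewrite natrX.
Qed.

End RowMoments.

(** * Truncated exponentials and the generating function of a row *)

Section TruncatedExponential.
Variable R : realType.
Implicit Types y : R.

Lemma texp_le_expR (p : nat) y : 0 <= y -> texp p y <= expR y.
Proof.
move=> y0.
have -> : texp p y = series (exp_coeff y) p.+1.
  by rewrite /texp /series /= big_mkord.
apply: nondecreasing_cvgn_le; last exact: is_cvg_series_exp_coeff.
by apply: nondecreasing_series => k _ _; rewrite exp_coeff_ge0.
Qed.

Lemma fact_double_le (p k : nat) : (k <= p)%N ->
  ((2 * k)`! <= (2 * p) ^ k * k`!)%N.
Proof.
move=> kp; rewrite mul2n -addnn.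
suff H i : (i <= k)%N -> ((k + i)`! <= (2 * p) ^ i * k`!)%N by apply: H.
elim: i => [|i IH] ik; first by rewrite addn0 mul1n.
by rewrite addnS factS expnS -mulnA leq_mul ?IH ?(ltnW ik) //; lia.
Qed.

Lemma sum_even_le (u : nat -> R) (p : nat) : (forall k, 0 <= u k) ->
  \sum_(k < p.+1) u (2 * k)%N <= \sum_(k < (2 * p).+1) u k.
Proof.
move=> u0; elim: p => [|p IH].
  by rewrite muln0 !big_ord_recr !big_ord0.
rewrite mulnS !addSn add0n big_ord_recr [leRHS]big_ord_recr [leRHS]/=.
by rewrite mulnS add2n lerD2r [leRHS]big_ord_recr /= ler_wpDr.
Qed.

(** With [z ^ 2 = 2 p y] and [k <= p], [fact_double_le] puts [y ^ k / k!] below the even term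
    [z ^ (2 k) / (2 k)!] of the series of [exp z]. *)
Lemma texp_le_expR_sqrt (p : nat) y : 0 <= y ->
  texp p y <= expR (Num.sqrt (2 * p%:R * y)).
Proof.
move=> y0; set z := Num.sqrt _.
have z0 : 0 <= z by apply: sqrtr_ge0.
have z2 : z ^+ 2 = 2 * p%:R * y by rewrite sqr_sqrtr // !mulr_ge0.
apply: le_trans (texp_le_expR (2 * p) z0).
pose u k := z ^+ k / k`!%:R.
have u0 k : 0 <= u k by rewrite divr_ge0 // exprn_ge0.
apply: (@le_trans _ _ (\sum_(k < p.+1) u (2 * k)%N)).
  apply: ler_sum => k _; rewrite /u exprM z2 exprMn.
  have kp : (k <= p)%N by rewrite -ltnS.
  have f0 (l : nat) : 0 < l`!%:R :> R by rewrite ltr0n fact_gt0.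
  rewrite ler_pdivrMr // [leRHS]mulrAC ler_pdivlMr //.
  rewrite [leRHS]mulrAC mulrC ler_wpM2r ?exprn_ge0 //.
  rewrite -natrM -natrX -natrM ler_nat.
  exact: fact_double_le.
exact: sum_even_le.
Qed.

(** The quotient [h ^ h / h!] is one term of the series of [exp h]. *)
Lemma expn_self_le_fact (h : nat) :
  h%:R ^+ h <= expR 1 ^+ h * h`!%:R :> R.
Proof.
rewrite -ler_pdivrMr ?ltr0n ?fact_gt0 // -expRM_natr mul1r.
apply: le_trans (texp_le_expR h _) => //.
by rewrite /texp big_ord_recr /= lerDr sumr_ge0.
Qed.

(** The elementary symmetric polynomial of the squares, times [h ^ h], is one part of the expansion
    of the product of all [1 + h x_j ^ 2], which is at most [exp (h |x| ^ 2)]. *)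
Lemma elementary_symmetric_le (n h : nat) (x : 'I_n -> R) :
  \sum_j x j ^+ 2 <= 1 ->
  h%:R ^+ h * \sum_(H : {set 'I_n} | #|H| == h) \prod_(j in H) x j ^+ 2
  <= expR 1 ^+ h.
Proof.
move=> x1.
apply: (@le_trans _ _ (\prod_j (h%:R * x j ^+ 2 + 1))).
  rewrite bigA_distr /= mulr_sumr [leLHS]big_mkcond; apply: ler_sum => H _.
  have -> : \prod_j (if j \in H then h%:R * x j ^+ 2 else 1) =
      h%:R ^+ #|H| * \prod_(j in H) x j ^+ 2.
    by rewrite -big_mkcond /= big_split prodr_const.
  case: eqP => [->//|_].
  by rewrite mulr_ge0 ?exprn_ge0 ?prodr_ge0 // => j _; rewrite sqr_ge0.
apply: (@le_trans _ _ (\prod_j expR (h%:R * x j ^+ 2))).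
  apply: ler_prod => j _.
  apply/andP; split; last by rewrite addrC expR_ge1Dx.
  by rewrite addr_ge0 // mulr_ge0 // sqr_ge0.
rewrite -expR_sum -mulr_sumr -expRM_natr mul1r ler_expR.
by rewrite -[leRHS]mulr1 ler_wpM2l.
Qed.

(** Monomials are grouped by the size [h] of their support. Summing over [k >= h] leaves a truncated
    exponential, because [(i + h)! >= i! h!]; summing over supports leaves an elementary symmetric
    polynomial. *)
Lemma row_generating_bound (n p : nat) (q tau nu : R) (x : 'I_n -> R) :
  0 <= q -> 0 <= tau -> (forall j, `|x j| <= nu) -> \sum_j x j ^+ 2 <= 1 ->
  \sum_(k < p.+1) tau ^+ k / k`!%:R * row_moment q x k <=
  1 + \sum_(h < p.+1 | (1 < h)%N)
        (expR 1 ^+ 2 * q * tau) ^+ h * texp p (tau * nu ^+ 2 * h%:R ^+ 2).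
Proof.
move=> q0 t0 xnu x1.
have f0 (l : nat) : 0 < l`!%:R :> R by rewrite ltr0n fact_gt0.
rewrite big_ord_recl /= row_moment0 expr0 fact0 divr1 mulr1 lerD2l.
pose G (H : {set 'I_n}) : R := q ^+ #|H| * \prod_(j in H) x j ^+ 2.
have G0 H : 0 <= G H.
  by rewrite mulr_ge0 ?exprn_ge0 // prodr_ge0 // => j _; rewrite sqr_ge0.
pose c (h k : nat) : R := tau ^+ k / k`!%:R * (h%:R ^+ (2 * k) * (nu ^+ 2) ^+ (k - h)).
have c0 h k : 0 <= c h k.
  apply: mulr_ge0; first by rewrite divr_ge0 // exprn_ge0.
  by apply: mulr_ge0; apply: exprn_ge0 => //; apply: sqr_ge0.
have th0 (h : nat) : 0 <= tau * h%:R ^+ 2 by rewrite mulr_ge0 // sqr_ge0.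
have y0 (h : nat) : 0 <= tau * nu ^+ 2 * h%:R ^+ 2.
  by apply: mulr_ge0; rewrite ?sqr_ge0 // mulr_ge0 // sqr_ge0.
pose T (h : nat) : R := texp p (tau * nu ^+ 2 * h%:R ^+ 2).
have T0 h : 0 <= T h.
  by apply: sumr_ge0 => k _; rewrite divr_ge0 // exprn_ge0.
have cT h : (h <= p)%N ->
    \sum_(k < p.+1 | (h <= k)%N) c h k <= (tau * h%:R ^+ 2) ^+ h / h`!%:R * T h.
  move=> hp; rewrite (_ : \sum_(k < p.+1 | _) _ = \sum_(0 + h <= k < p.+1) c h k).
    2: by rewrite add0n big_geq_mkord.
  rewrite big_addn.
  apply: (@le_trans _ _ (\sum_(0 <= i < p.+1 - h) (tau * h%:R ^+ 2) ^+ h / h`!%:R *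
      ((tau * nu ^+ 2 * h%:R ^+ 2) ^+ i / i`!%:R))).
    apply: ler_sum => i _; rewrite /c addnK.
    have -> : tau ^+ (i + h) / (i + h)`!%:R *
       (h%:R ^+ (2 * (i + h)) * (nu ^+ 2) ^+ i) =
      (tau * h%:R ^+ 2) ^+ h * (tau * nu ^+ 2 * h%:R ^+ 2) ^+ i *
      ((i + h)`!%:R)^-1.
      by rewrite exprM !exprD !exprMn; ring.
    have -> : (tau * h%:R ^+ 2) ^+ h / h`!%:R *
      ((tau * nu ^+ 2 * h%:R ^+ 2) ^+ i / i`!%:R) =
      (tau * h%:R ^+ 2) ^+ h * (tau * nu ^+ 2 * h%:R ^+ 2) ^+ i *
      (i`!%:R * h`!%:R)^-1 by rewrite invfM; ring.
    rewrite ler_wpM2l //.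
      by apply: mulr_ge0; apply: exprn_ge0.
    rewrite lef_pV2 ?posrE ?mulr_gt0 // -natrM ler_nat.
    rewrite -(@bin_fact (i + h) i) ?leq_addr // addKn leq_pmull // bin_gt0.
    by rewrite leq_addr.
  rewrite -mulr_sumr ler_wpM2l //.
    by rewrite divr_ge0 // exprn_ge0.
  rewrite big_mkord /T /texp; pose v (i : nat) : R := (tau * nu ^+ 2 * h%:R ^+ 2) ^+ i / i`!%:R.
  rewrite (big_ord_widen p.+1 v) ?leq_subr // big_mkcond /=.
  apply: ler_sum => i _; case: ifP => // _.
  by rewrite /v divr_ge0 // exprn_ge0.
apply: (@le_trans _ _ (\sum_(i < p) \sum_(H : {set 'I_n} | (1 < #|H| <= i.+1)%N)
    c #|H| i.+1 * G H)).
  apply: ler_sum => i _; rewrite /bump /= add1n.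
  apply: le_trans (ler_wpM2l _ (row_moment_bound q0 xnu (ltn0Sn i))) _.
    by rewrite divr_ge0 // exprn_ge0.
  rewrite mulr_sumr; apply: ler_sum => H _; rewrite /c /G le_eqVlt.
  by apply/orP; left; apply/eqP; ring.
rewrite (exchange_big_dep (fun H : {set 'I_n} => (1 < #|H| <= p)%N)) /=; last first.
  by move=> i H _ /andP[-> /= /leq_trans]; apply.
apply: (@le_trans _ _ (\sum_(H : {set 'I_n} | (1 < #|H| <= p)%N)
    ((tau * #|H|%:R ^+ 2) ^+ #|H| / (#|H|)`!%:R * T #|H|) * G H)).
  apply: ler_sum => H /andP[H1 Hp]; rewrite -mulr_suml ler_wpM2r //.
  apply: le_trans (cT _ Hp).
  rewrite [leRHS]big_mkcond big_ord_recl /= -[leLHS]add0r lerD //.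
    by case: ifP.
  by rewrite -big_mkcond /= H1.
apply: (@le_trans _ _ (\sum_(h < p.+1 | (1 < h)%N)
   \sum_(H : {set 'I_n} | #|H| == h)
    ((tau * h%:R ^+ 2) ^+ h / h`!%:R * T h) * G H)).
  rewrite (exchange_big_dep predT) //= [leLHS]big_mkcond /=.
  apply: ler_sum => H _.
  have hs0 (h : nat) : 0 <= (tau * h%:R ^+ 2) ^+ h / h`!%:R * T h * G H.
    by apply: mulr_ge0 => //; apply: mulr_ge0 => //; rewrite divr_ge0 ?exprn_ge0.
  case: ifP => [/andP[H1 Hp]|_]; last exact: sumr_ge0.
  by rewrite (bigD1 (Ordinal (Hp : (#|H| < p.+1)%N))) /= ?H1 ?eqxx // ler_wpDr ?sumr_ge0.
apply: ler_sum => h h1; rewrite -mulr_sumr /G.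
rewrite (eq_bigr (fun H : {set 'I_n} => q ^+ h * \prod_(j in H) x j ^+ 2)); last first.
  by move=> H /eqP ->.
rewrite -mulr_sumr -/(T h) mulrAC ler_wpM2r //.
set e2 := \sum_(H | _) _.
have e20 : 0 <= e2.
  by apply: sumr_ge0 => H _; apply: prodr_ge0 => j _; rewrite sqr_ge0.
(* Of the factor [h ^ (2 h)], one half is absorbed by [A] and the other, against [h!], by [B]; each
   costs [e ^ h]. *)
have A := elementary_symmetric_le h x1; rewrite -/e2 in A.
have B := expn_self_le_fact h.
rewrite mulrAC ler_pdivrMr //.
have -> : (tau * h%:R ^+ 2) ^+ h * (q ^+ h * e2) =
    (q * tau) ^+ h * ((h%:R ^+ h * e2) * h%:R ^+ h) by rewrite !(exprMn, expr2); ring.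
have -> : (expR 1 ^+ 2 * q * tau) ^+ h * h`!%:R =
    (q * tau) ^+ h * (expR 1 ^+ h * (expR 1 ^+ h * h`!%:R)).
  by rewrite !(exprMn, expr2); ring.
rewrite ler_wpM2l ?exprn_ge0 ?mulr_ge0 // ler_pM ?mulr_ge0 ?exprn_ge0 //.
Qed.

End TruncatedExponential.

(** * Tail bound for the distortion of a fixed vector *)

Section HashingTail.
Variable R : realType.

Lemma l2norm_sqr (p q : nat) (x : 'M[R]_(p, q)) :
  l2norm x ^+ 2 = \sum_i \sum_j x i j ^+ 2.
Proof.
rewrite /l2norm sqr_sqrtr // sumr_ge0 // => i _.
by rewrite sumr_ge0 // => j _; rewrite sqr_ge0.
Qed.

Lemma l2norm_sqr_col (p : nat) (x : 'cV[R]_p) :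
  l2norm x ^+ 2 = \sum_i x i 0 ^+ 2.
Proof. by rewrite l2norm_sqr; apply: eq_bigr => i _; rewrite big_ord1. Qed.

Lemma sqr_sum_offdiag (n : nat) (x e : 'I_n -> R) :
  (\sum_j e j * x j) ^+ 2 =
  \sum_j e j ^+ 2 * x j ^+ 2 + \sum_jj offdiag x jj * (e jj.1 * e jj.2).
Proof.
rewrite expr2 mulr_suml.
under eq_bigr do rewrite mulr_sumr.
rewrite -(pair_bigA _ (fun j k => offdiag x (j, k) * (e j * e k))) -big_split /=.
apply: eq_bigr => j _; rewrite (bigD1 j) // [in RHS](bigD1 j) //=.
rewrite /offdiag /= eqxx mul0r add0r; congr (_ + _); first by ring.
by apply: eq_bigr => k; rewrite eq_sym => /negPf ->; ring.
Qed.

(** Every column of unnormalized entries has squared norm exactly [s], so the diagonal terms cancel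
    [s |x| ^ 2]. *)
Lemma hashing_distortion (m n s : nat) (w : hashing_sample m n s) (x : 'cV[R]_n) :
  (0 < s)%N ->
  s%:R * (l2norm (hashing_mx R w *m x) ^+ 2 - l2norm x ^+ 2) =
  \sum_(th : 'I_m * ('I_n * 'I_n)) offdiag (fun j => x j 0) th.2 *
    (entry R w (th.1, th.2.1) * entry R w (th.1, th.2.2)).
Proof.
move=> s0; rewrite !l2norm_sqr_col mulrBr !mulr_sumr.
have sR : s%:R != 0 :> R by rewrite pnatr_eq0 -lt0n.
have rowE i : s%:R * (hashing_mx R w *m x) i 0 ^+ 2 =
    (\sum_j entry R w (i, j) * x j 0) ^+ 2.
  rewrite mxE.
  rewrite (eq_bigr (fun j => (Num.sqrt s%:R)^-1 * (entry R w (i, j) * x j 0))); last first.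
    move=> j _; rewrite mxE -mulr_suml /entry /col_entry /=; ring.
  by rewrite -mulr_sumr exprMn exprVn sqr_sqrtr // mulrA mulfV // mul1r.
rewrite (eq_bigr _ (fun i _ => rowE i)).
under eq_bigr do rewrite sqr_sum_offdiag.
rewrite big_split /= exchange_big /=.
rewrite (eq_bigr (fun j => s%:R * x j 0 ^+ 2)); last first.
  by move=> j _; rewrite -mulr_suml -(col_entry_sqr_sum R (w j : hash_column m s)).
rewrite addrAC subrr add0r pair_bigA /=.
by apply: eq_bigr => -[i [j k]] _.
Qed.

Lemma hashing_moment_bound (m n s p : nat) (x : 'cV[R]_n) (tau : R) :
  (0 < s)%N -> (s <= m)%N -> 0 <= tau ->
  tau ^+ p * \sum_(w : hashing_sample m n s)
    (s%:R * (l2norm (hashing_mx R w *m x) ^+ 2 - l2norm x ^+ 2)) ^+ p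
  <= #|hashing_sample m n s|%:R * (p`!%:R *
     (\sum_(k < p.+1) tau ^+ k / k`!%:R *
        row_moment (s%:R / m%:R) (fun j => x j 0) k) ^+ m).
Proof.
move=> s0 sm t0; have m0 := leq_trans s0 sm.
have q0 : 0 <= s%:R / m%:R :> R by rewrite divr_ge0.
have A := moment_sum_iid m p t0 (fun k => row_moment_ge0 (fun j => x j 0) k q0).
apply: le_trans (ler_wpM2l (ler0n _ _) A).
rewrite mulrCA ler_wpM2l ?exprn_ge0 //.
under eq_bigr do rewrite hashing_distortion //.
have B := moment_comparison sm m0 (fun th : 'I_m * ('I_n * 'I_n) =>
  offdiag (fun j => x j 0) th.2)
  (fun th b => (th.1, if b then th.2.2 else th.2.1)) p.
apply: le_trans B _; rewrite ler_wpM2l //.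
rewrite le_eqVlt; apply/orP; left; apply/eqP.
apply: eq_bigr => a _; congr (_ * _ ^+ _).
by rewrite /row_form pair_bigA; apply: eq_bigr => -[i jj] _.
Qed.

(* Markov's inequality for the [p]-th moment, with [tau = e^2 p / (s eps)] in
   [hashing_moment_bound]. *)
Lemma hashing_tail (m n s p : nat) (x : 'cV[R]_n) (nu eps : R) :
  (0 < s)%N -> (s <= m)%N -> (0 < p)%N -> ~~ odd p -> 0 < eps ->
  (forall j, `|x j 0| <= nu) -> l2norm x ^+ 2 <= 1 ->
  m%:R * (\sum_(h < p.+1 | (1 < h)%N)
    (expR 1 ^+ 4 * p%:R / (m%:R * eps)) ^+ h *
    texp p (expR 1 ^+ 2 * p%:R * nu ^+ 2 / (s%:R * eps) * h%:R ^+ 2)) <= p%:R ->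
  #|[set w : hashing_sample m n s |
      eps < `|l2norm (hashing_mx R w *m x) ^+ 2 - l2norm x ^+ 2|]%SET|%:R
  <= #|hashing_sample m n s|%:R * expR 1 ^- p :> R.
Proof.
move=> s0 sm p0 ep eps0 xnu x1 Sp.
have m0 := leq_trans s0 sm.
have sR : 0 < s%:R :> R by rewrite ltr0n.
have mR : 0 < m%:R :> R by rewrite ltr0n.
have pR : 0 < p%:R :> R by rewrite ltr0n.
have e0 : 0 < expR 1 :> R by apply: expR_gt0.
pose tau : R := expR 1 ^+ 2 * p%:R / (s%:R * eps).
have tau0 : 0 < tau by rewrite divr_gt0 ?mulr_gt0 ?exprn_gt0.
set B := [set w | _]%SET; set N : R := #|hashing_sample m n s|%:R.
pose Z (w : hashing_sample m n s) : R :=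
  l2norm (hashing_mx R w *m x) ^+ 2 - l2norm x ^+ 2.
have Zp w : 0 <= (s%:R * Z w) ^+ p.
  by rewrite -(odd_double_half p) (negPf ep) add0n -mul2n exprM exprn_ge0 // sqr_ge0.
(* Markov's inequality; [p] is even, so no sample contributes negatively. *)
have low : #|B|%:R * (s%:R * eps) ^+ p <= \sum_w (s%:R * Z w) ^+ p.
  rewrite mulrC mulr_natr -sumr_const [leLHS]big_mkcond /=.
  apply: ler_sum => w _; case: ifP => // wB.
  have -> : (s%:R * Z w) ^+ p = `|s%:R * Z w| ^+ p.
    by rewrite -normrX ger0_norm.
  move: wB; rewrite inE => wB.
  rewrite lerXn2r ?nnegrE ?mulr_ge0 // ?(ltW eps0) //.
  by rewrite normrM ger0_norm // ler_wpM2l // ltW.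
have gen := row_generating_bound (n := n) p (q := s%:R / m%:R) (tau := tau) (nu := nu)
  (x := fun j => x j 0) (divr_ge0 (ler0n _ _) (ler0n _ _)) (ltW tau0) xnu.
rewrite -l2norm_sqr_col in gen; move: (gen x1) => {}gen.
set S := \sum_(h < p.+1 | (1 < h)%N) _ in gen.
have SE : m%:R * S <= p%:R.
  apply: le_trans Sp; rewrite ler_wpM2l // /S le_eqVlt; apply/orP; left; apply/eqP.
  apply: eq_bigr => h _; congr (_ ^+ _ * texp _ (_ * _)).
    by rewrite /tau; field; rewrite !gt_eqF.
  by rewrite /tau mulrAC.
(* This combines [1 + S <= exp S] with [m S <= p]. *)
have gm : (\sum_(k < p.+1) tau ^+ k / k`!%:R *
        row_moment (s%:R / m%:R) (fun j => x j 0) k) ^+ m <= expR 1 ^+ p.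
  apply: (@le_trans _ _ ((expR S) ^+ m)).
    rewrite lerXn2r ?nnegrE ?(ltW (expR_gt0 _)) //.
      apply: sumr_ge0 => k _; rewrite mulr_ge0 ?divr_ge0 ?exprn_ge0 ?(ltW tau0) //.
      by rewrite row_moment_ge0 // divr_ge0.
    by apply: le_trans gen _; rewrite expR_ge1Dx.
  by rewrite -!expRM_natr mul1r ler_expR mulrC.
have mom := hashing_moment_bound p x s0 sm (ltW tau0).
have fp : p`!%:R <= p%:R ^+ p :> R.
  rewrite -natrX ler_nat; elim: (p) => // k IH; rewrite factS expnS leq_mul //.
  by apply: leq_trans IH _; case: k => // k; rewrite leq_exp2r.
(* The choice of [tau] yields [e ^ (2 p) p ^ p]; the bounds on [p!] and on the generating function
   consume [p ^ p] and [e ^ p]. *)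
have ts : tau ^+ p * (s%:R * eps) ^+ p = expR 1 ^+ p * expR 1 ^+ p * p%:R ^+ p.
  rewrite -!exprMn; congr (_ ^+ _); rewrite /tau; field; rewrite !gt_eqF //.
rewrite ler_pdivlMr ?exprn_gt0 //.
have pp0 : 0 < p%:R ^+ p :> R by rewrite exprn_gt0.
have ep0 : 0 < expR 1 ^+ p :> R by rewrite exprn_gt0.
rewrite -(ler_pM2r (mulr_gt0 pp0 ep0)).
apply: (@le_trans _ _ (tau ^+ p * (#|B|%:R * (s%:R * eps) ^+ p))).
  by rewrite [leRHS]mulrCA ts le_eqVlt; apply/orP; left; apply/eqP; ring.
apply: le_trans (ler_wpM2l (exprn_ge0 _ (ltW tau0)) low) _.
apply: le_trans mom _; rewrite ler_wpM2l //.
rewrite ler_pM ?ler0n // exprn_ge0 // sumr_ge0 // => k _.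
rewrite mulr_ge0 ?divr_ge0 ?exprn_ge0 ?(ltW tau0) //.
by rewrite row_moment_ge0 // divr_ge0.
Qed.

End HashingTail.

(** * Estimates of the series over support sizes *)

Section NumericBounds.
Variable R : realType.

Lemma sum_from2_geometric (F : nat -> R) (A z : R) (N : nat) :
  0 <= A -> 0 <= z -> z <= 2^-1 -> F 2%N <= A ->
  (forall h, (2 < h)%N -> F h <= z ^+ h) ->
  \sum_(h < N | (1 < h)%N) F h <= A + 2 * z ^+ 3.
Proof.
move=> A0 z0 z1 FA Fz; rewrite big_mkcond /=.
have z30 : 0 <= z ^+ 3 by rewrite exprn_ge0.
(* The summand [2 z ^ (k + 3)] stands for the geometric tail still to come; [z <= 1 / 2] makes the
   left side nonincreasing in [k]. *)
have step k : \sum_(h < k + 3) (if (1 < h)%N then F h else 0) + 2 * z ^+ (k + 3)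
    <= A + 2 * z ^+ 3.
  elim: k => [|k IH].
    by rewrite add0n !big_ord_recr big_ord0 /= !add0r lerD2r.
  rewrite addSn big_ord_recr /= ifT; last by lia.
  apply: le_trans IH; rewrite -addrA lerD2l exprS.
  have := Fz (k + 3)%N; have : 0 <= z ^+ (k + 3) by rewrite exprn_ge0.
  set y := z ^+ (k + 3) => y0 /(_ ltac:(lia)); nra.
have [N3|N3] := leqP 3 N.
  apply: le_trans (step (N - 3)%N); rewrite subnK //.
  by rewrite ler_wpDr // mulr_ge0 // exprn_ge0.
rewrite big1 => [|h _]; first by rewrite addr_ge0 // mulr_ge0.
by rewrite ifF //; have := ltn_ord h; lia.
Qed.

(** The exponent in [texp_le_expR_sqrt] is linear in [h], so the terms [h >= 3] are at most
    geometric of ratio [beta * gam]; the term [h = 2] keeps the plain bound [exp (4 a)]. *)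
Lemma texp_series_bound (p : nat) (beta a gam : R) :
  0 <= beta -> 0 <= a -> expR (Num.sqrt (2 * p%:R * a)) <= gam ->
  beta * gam <= 2^-1 ->
  \sum_(h < p.+1 | (1 < h)%N) beta ^+ h * texp p (a * h%:R ^+ 2)
  <= beta ^+ 2 * expR (4 * a) + 2 * (beta * gam) ^+ 3.
Proof.
move=> b0 a0 eg bg.
have g0 : 0 <= gam by apply: le_trans eg; apply/ltW/expR_gt0.
apply: (sum_from2_geometric (F := fun h => beta ^+ h * texp p (a * h%:R ^+ 2))) => //.
- by rewrite mulr_ge0 ?exprn_ge0 // ltW // expR_gt0.
- exact: mulr_ge0.
- rewrite ler_wpM2l ?exprn_ge0 //.
  apply: le_trans (texp_le_expR _ _) _; first by rewrite mulr_ge0 // sqr_ge0.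
  by rewrite ler_expR -natrX; lra.
move=> h _; rewrite exprMn ler_wpM2l ?exprn_ge0 //.
apply: le_trans (texp_le_expR_sqrt _ _) _; first by rewrite mulr_ge0 // sqr_ge0.
rewrite mulrA sqrtrM ?mulr_ge0 // sqrtr_sqr ger0_norm //.
by rewrite expRM_natr lerXn2r ?nnegrE // ltW // expR_gt0.
Qed.

(* [p <= 14 L] and [m >= E L / eps ^ 2] give the base [beta] of the series below the
   value [tail_const * eps / E]. *)
Definition tail_const : R := 56 * expR 1 ^+ 4.

(** It makes [(e * coherence_const) ^ 2 = 2 ^ -14], small enough for both [a8] and [pa] in
    [tail_series_le]. *)
Definition coherence_const : R := (128 * expR 1)^-1.

Lemma tail_const_ge1 : 1 <= tail_const.
Proof.
have e1 : 1 <= expR 1 ^+ 4 :> R by rewrite exprn_ege1 // -expR0 ler_expR.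
by rewrite /tail_const; lra.
Qed.

(* The term [h = 2] uses only [ln E]; the geometric decay of the terms [h >= 3]
   absorbs a power of [E / eps]. This is the minimum in [mu_bar]. *)
Lemma tail_series_le (p m s : nat) (L E eps nu : R) :
  (0 < s)%N -> 0 < L -> 0 < eps -> eps < 1 -> 4 * tail_const ^+ 4 <= E ->
  p%:R <= 14 * L -> E * eps ^- 2 * L <= m%:R ->
  0 <= nu ->
  nu <= Num.sqrt s%:R * coherence_const *
    (Num.sqrt eps * Num.min (ln (E / eps) / L) (Num.sqrt (ln E / L))) ->
  m%:R * (\sum_(h < p.+1 | (1 < h)%N)
    (expR 1 ^+ 4 * p%:R / (m%:R * (eps / 4))) ^+ h *
    texp p (expR 1 ^+ 2 * p%:R * nu ^+ 2 / (s%:R * (eps / 4)) * h%:R ^+ 2)) <= p%:R.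
Proof.
move=> s0 L0 eps0 eps1 EC pL mE nu0 nub.
have c1 := tail_const_ge1; set c := tail_const in EC c1.
have e0 : 0 < expR 1 :> R by apply: expR_gt0.
have c0 : 0 < c by lra.
have E1 : 1 < E.
  have : 1 <= c ^+ 4 by rewrite exprn_ege1.
  lra.
have E0 : 0 < E by lra.
have sR : 0 < s%:R :> R by rewrite ltr0n.
have p0 : 0 <= p%:R :> R by [].
have m0 : 0 < m%:R :> R.
  by apply: lt_le_trans mE; rewrite !mulr_gt0 ?invr_gt0 ?exprn_gt0.
set beta := expR 1 ^+ 4 * p%:R / _.
set a := expR 1 ^+ 2 * p%:R * nu ^+ 2 / _.
have Ee : 1 < E / eps by rewrite ltr_pdivlMr // mul1r (lt_trans eps1).
have lE : 0 < ln E by rewrite ln_gt0.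
have lEe : 0 < ln (E / eps) by rewrite ln_gt0.
set M := Num.min _ _ in nub.
have M0 : 0 <= M by rewrite /M le_min sqrtr_ge0 divr_ge0 // ltW.
have nu2 : nu ^+ 2 <= s%:R * coherence_const ^+ 2 * (eps * M ^+ 2).
  have -> : s%:R * coherence_const ^+ 2 * (eps * M ^+ 2) =
     (Num.sqrt s%:R * coherence_const * (Num.sqrt eps * M)) ^+ 2.
    by rewrite !exprMn !sqr_sqrtr // ltW.
  by rewrite lerXn2r ?nnegrE // (le_trans nu0).
have aM : a <= 56 * expR 1 ^+ 2 * coherence_const ^+ 2 * (L * M ^+ 2).
  rewrite /a ler_pdivrMr ?mulr_gt0 // ?divr_gt0 //.
  have X : expR 1 ^+ 2 * p%:R * nu ^+ 2 <=
     expR 1 ^+ 2 * (14 * L) * (s%:R * coherence_const ^+ 2 * (eps * M ^+ 2)).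
    by rewrite ler_pM ?mulr_ge0 ?sqr_ge0 // ?ler_wpM2l ?sqr_ge0.
  apply: le_trans X _; rewrite le_eqVlt; apply/orP; left; apply/eqP; field; rewrite ?gt_eqF //.
pose k : R := expR 1 ^+ 2 * coherence_const ^+ 2.
have k1 : 16 * (16 * (8 * (8 * k))) = 1.
  by rewrite /k /coherence_const; field; rewrite gt_eqF.
have k0 : 0 <= k by rewrite mulr_ge0 ?sqr_ge0.
have aM' : a <= 56 * k * (L * M ^+ 2).
  by apply: le_trans aM _; rewrite /k !mulrA.
have a0 : 0 <= a.
  by rewrite /a divr_ge0 ?mulr_ge0 ?sqr_ge0 // ltW // divr_gt0.
have M1 : M <= ln (E / eps) / L by rewrite /M ge_min lexx.
have M2 : M ^+ 2 <= ln E / L.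
  rewrite -[leRHS]sqr_sqrtr; last by rewrite divr_ge0 // ltW.
  by rewrite lerXn2r ?nnegrE ?sqrtr_ge0 // /M ge_min lexx orbT.
(* From the second entry of the minimum; it puts [exp (4 a)] below the square root of [E]. *)
have a8 : 8 * a <= ln E.
  have LME : L * M ^+ 2 <= ln E by rewrite mulrC -ler_pdivlMr.
  have : k * (L * M ^+ 2) <= k * ln E by rewrite ler_wpM2l.
  have : 16 * (16 * (8 * (8 * (k * ln E)))) = ln E by rewrite -[RHS]mul1r -[in RHS]k1; ring.
  have : 0 <= k * ln E by rewrite mulr_ge0 // ltW.
  lra.
(* From the first entry of the minimum; it amounts to [g ^ 3 <= E / eps] for the [g] below. *)
have pa : 3 * Num.sqrt (2 * p%:R * a) <= ln (E / eps).
  have LM : L * M <= ln (E / eps) by rewrite mulrC -ler_pdivlMr.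
  have l3 : 0 <= ln (E / eps) / 3 by rewrite divr_ge0 // ltW.
  suff : Num.sqrt (2 * p%:R * a) <= ln (E / eps) / 3 by lra.
  rewrite -[leRHS]ger0_norm // -sqrtr_sqr ler_wsqrtr //.
  have LM2 : (L * M) ^+ 2 <= ln (E / eps) ^+ 2.
    by rewrite lerXn2r ?nnegrE ?mulr_ge0 // ltW.
  have pa1 : p%:R * a <= (14 * L) * (56 * k * (L * M ^+ 2)) by rewrite ler_pM.
  have -> : 2 * p%:R * a = 2 * (p%:R * a) by rewrite mulrA.
  have -> : (ln (E / eps) / 3) ^+ 2 = ln (E / eps) ^+ 2 / 9 by field.
  have K2 : 0 <= k * (L * M) ^+ 2 by rewrite mulr_ge0 ?sqr_ge0.
  have E1' : 14 * L * (56 * k * (L * M ^+ 2)) = 14 * (56 * (k * (L * M) ^+ 2)) by ring.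
  have E2 : 16 * (16 * (8 * (8 * (k * (L * M) ^+ 2)))) = (L * M) ^+ 2.
    by rewrite -[RHS]mul1r -[in RHS]k1; ring.
  move: pa1; rewrite E1'; lra.
have b0 : 0 <= beta by rewrite /beta divr_ge0 ?mulr_ge0 // ltW // divr_gt0.
have cE : c = 56 * expR 1 ^+ 4 by [].
have ce0 : 0 <= c * (eps / E) by apply/ltW; rewrite mulr_gt0 ?divr_gt0.
have cp0 : 0 <= c * (p%:R / eps).
  by apply: mulr_ge0; rewrite ?divr_ge0 // ltW.
(* The numeral 56 in [c] is [4 * 14], from [eps / 4] and from [p <= 14 L]. *)
have bE : beta <= c * (eps / E).
  rewrite /beta ler_pdivrMr ?mulr_gt0 ?divr_gt0 //.
  apply: (@le_trans _ _ (expR 1 ^+ 4 * (14 * L))); first by rewrite ler_wpM2l // ltW.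
  have -> : expR 1 ^+ 4 * (14 * L) =
     c * (eps / E) * ((E * eps ^- 2 * L) * (eps / 4)).
    by rewrite cE; field; rewrite !gt_eqF.
  by rewrite ler_wpM2l // ler_wpM2r // ltW // divr_gt0.
have mb : m%:R * beta <= c * (p%:R / eps).
  have -> : m%:R * beta = c * (p%:R / eps) * (4 / 56).
    by rewrite /beta cE; field; rewrite !gt_eqF.
  by rewrite ler_piMr //; lra.
pose g := expR (Num.sqrt (2 * p%:R * a)).
have g0 : 0 < g by apply: expR_gt0.
have g1 : 1 <= g by rewrite -expR0 ler_expR sqrtr_ge0.
have g3 : g ^+ 3 <= E / eps.
  rewrite /g -expRM_natr mulrC -[leRHS]lnK ?posrE; last by rewrite divr_gt0.
  by rewrite ler_expR.
have c2E : 4 * c ^+ 2 <= E.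
  by apply: le_trans EC; rewrite ler_wpM2l // ler_weXn2l.
have c3E : 4 * c ^+ 3 <= E.
  by apply: le_trans EC; rewrite ler_wpM2l // ler_weXn2l.
have b2 : beta ^+ 2 <= c ^+ 2 * (eps / E) ^+ 2.
  by rewrite -exprMn lerXn2r ?nnegrE.
have bg3 : beta ^+ 2 * g ^+ 3 <= c ^+ 2 * eps / E.
  have -> : c ^+ 2 * eps / E = c ^+ 2 * (eps / E) ^+ 2 * (E / eps).
    by field; rewrite !gt_eqF.
  by rewrite ler_pM ?exprn_ge0 // ltW.
have bg : beta * g <= 2^-1.
  have h2 : 0 <= 2^-1 :> R by rewrite invr_ge0.
  suff : (beta * g) ^+ 2 <= 2^-1 ^+ 2.
    by rewrite ler_pXn2r // nnegrE mulr_ge0 // ltW.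
  rewrite exprMn.
  apply: (@le_trans _ _ (beta ^+ 2 * g ^+ 3)).
    by rewrite ler_wpM2l ?sqr_ge0 // ler_weXn2l.
  apply: le_trans bg3 _; rewrite ler_pdivrMr //.
  have : c ^+ 2 * eps <= c ^+ 2 by rewrite ler_piMr ?sqr_ge0 // ltW.
  have -> : (2^-1 : R) ^+ 2 = 4^-1 by field.
  lra.
apply: le_trans (ler_wpM2l (ler0n _ _) (texp_series_bound b0 a0 (lexx _) bg)) _.
rewrite -/g mulrDr.
(* Half of [p] pays for the term [h = 2], where [4 c ^ 4 <= E] enters; [X2] spends the other half on
   the rest. *)
have X1 : m%:R * (beta ^+ 2 * expR (4 * a)) <= p%:R / 2.
  have eX : 2 * c ^+ 2 * expR (4 * a) <= E.
    have x0 := expR_gt0 (4 * a).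
    suff : (2 * c ^+ 2 * expR (4 * a)) ^+ 2 <= E ^+ 2.
      by rewrite ler_pXn2r // nnegrE ?mulr_ge0 ?sqr_ge0 // ltW.
    have e8 : expR (4 * a) ^+ 2 <= E.
      rewrite -expRM_natr -[leRHS]lnK ?posrE // ler_expR; lra.
    have -> : (2 * c ^+ 2 * expR (4 * a)) ^+ 2 = 4 * c ^+ 4 * expR (4 * a) ^+ 2 by ring.
    by rewrite [leRHS]expr2 ler_pM ?mulr_ge0 ?exprn_ge0 ?(ltW x0) ?(ltW c0).
  have -> : m%:R * (beta ^+ 2 * expR (4 * a)) = (m%:R * beta) * (beta * expR (4 * a)).
    ring.
  apply: (@le_trans _ _ (c * (p%:R / eps) * (c * (eps / E) * expR (4 * a)))).
    have x0 : 0 <= expR (4 * a) by apply/ltW/expR_gt0.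
    apply: ler_pM; [exact: mulr_ge0|exact: mulr_ge0|exact: mb|exact: ler_wpM2r].
  have -> : c * (p%:R / eps) * (c * (eps / E) * expR (4 * a)) =
     p%:R / 2 * (2 * c ^+ 2 * expR (4 * a) / E) by field; rewrite !gt_eqF.
  by rewrite ler_piMr ?divr_ge0 // ler_pdivrMr // mul1r.
have X2 : m%:R * (2 * (beta * g) ^+ 3) <= p%:R / 2.
  have -> : m%:R * (2 * (beta * g) ^+ 3) = 2 * ((m%:R * beta) * (beta ^+ 2 * g ^+ 3)).
    ring.
  apply: (@le_trans _ _ (2 * (c * (p%:R / eps) * (c ^+ 2 * eps / E)))).
    rewrite ler_wpM2l //; apply: ler_pM => //; first by rewrite mulr_ge0.
    by rewrite mulr_ge0 ?exprn_ge0 // ltW.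
  have -> : 2 * (c * (p%:R / eps) * (c ^+ 2 * eps / E)) =
     p%:R / 2 * (4 * c ^+ 3 / E) by field; rewrite !gt_eqF.
  by rewrite ler_piMr ?divr_ge0 // ler_pdivrMr // mul1r.
lra.
Qed.

End NumericBounds.

(** * Quadratic forms and a net of the unit ball *)

Section QuadraticForms.
Variables (R : realType).

Definition bil (n : nat) (G : 'M[R]_n) (u v : 'cV[R]_n) : R := (u^T *m G *m v) 0 0.

Section Bilinear.
Variables (n : nat) (G : 'M[R]_n).
Implicit Types u v w : 'cV[R]_n.

Lemma bilDl u v w : bil G (u + v) w = bil G u w + bil G v w.
Proof. by rewrite /bil linearD /= !mulmxDl mxE. Qed.

Lemma bilDr u v w : bil G w (u + v) = bil G w u + bil G w v.
Proof. by rewrite /bil mulmxDr mxE. Qed.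

Lemma bilZl a u w : bil G (a *: u) w = a * bil G u w.
Proof. by rewrite /bil linearZ /= -!scalemxAl mxE. Qed.

Lemma bilZr a u w : bil G w (a *: u) = a * bil G w u.
Proof. by rewrite /bil -scalemxAr mxE. Qed.

Lemma bilNl u w : bil G (- u) w = - bil G u w.
Proof. by rewrite -scaleN1r bilZl mulN1r. Qed.

Lemma bilNr u w : bil G w (- u) = - bil G w u.
Proof. by rewrite -scaleN1r bilZr mulN1r. Qed.

Lemma bil_sym u v : G^T = G -> bil G u v = bil G v u.
Proof.
move=> sG; rewrite /bil.
have -> : u^T *m G *m v = (v^T *m G *m u)^T by rewrite !trmx_mul trmxK sG mulmxA.
by rewrite mxE.
Qed.

Lemma bilE u v : bil G u v = \sum_i \sum_j u i 0 * G i j * v j 0.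
Proof.
rewrite /bil mxE; under eq_bigr do rewrite mxE mulr_suml.
rewrite exchange_big /=; apply: eq_bigr => i _; apply: eq_bigr => j _.
by rewrite mxE.
Qed.

Lemma bil_lincomb (a b : R) (H : 'M[R]_n) u v :
  bil (a *: G + b *: H) u v = a * bil G u v + b * bil H u v.
Proof. by rewrite /bil mulmxDr mulmxDl -!scalemxAr -!scalemxAl !mxE. Qed.

Lemma bil_entry_bound (a b : R) u v :
  (forall i, `|u i 0| <= a) -> (forall i, `|v i 0| <= b) ->
  `|bil G u v| <= (\sum_i \sum_j `|G i j|) * (a * b).
Proof.
move=> ua vb; rewrite bilE mulr_suml; apply: le_trans (ler_norm_sum _ _ _) _.
apply: ler_sum => i _; rewrite mulr_suml; apply: le_trans (ler_norm_sum _ _ _) _.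
apply: ler_sum => j _; rewrite !normrM mulrAC mulrC ler_wpM2l // ler_pM //.
Qed.

End Bilinear.

Lemma bil1E (n : nat) (u v : 'cV[R]_n) : bil 1%:M u v = \sum_i u i 0 * v i 0.
Proof. by rewrite /bil mulmx1 mxE; apply: eq_bigr => i _; rewrite mxE. Qed.

Lemma l2norm_bil (n : nat) (u : 'cV[R]_n) : l2norm u ^+ 2 = bil 1%:M u u.
Proof. by rewrite l2norm_sqr_col bil1E. Qed.

Lemma bil1_ge0 (n : nat) (u : 'cV[R]_n) : 0 <= bil 1%:M u u.
Proof. by rewrite -l2norm_bil sqr_ge0. Qed.

Lemma bil1_eq0 (n : nat) (u : 'cV[R]_n) : bil 1%:M u u = 0 -> u = 0.
Proof.
rewrite bil1E => /eqP; rewrite psumr_eq0 => [/allP u0|i _]; last by rewrite -expr2 sqr_ge0.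
apply/colP => i; rewrite mxE; apply/eqP.
by have := u0 i (mem_index_enum _); rewrite mulf_eq0 orbb.
Qed.

Lemma entry_le_bil1 (n : nat) (u : 'cV[R]_n) i : bil 1%:M u u <= 1 -> `|u i 0| <= 1.
Proof.
rewrite bil1E => u1.
rewrite -(ler_pXn2r (n := 2)) ?nnegrE // expr1n real_normK ?num_real //.
apply: le_trans u1; rewrite (bigD1 i) //= -expr2 ler_wpDr // sumr_ge0 // => j _.
by rewrite -expr2 sqr_ge0.
Qed.

(** Rounding [N x] down to an integer vector changes the form by terms at most linear in [N], while
    a negative value [- b] at [x] contributes [- b N ^ 2]. *)
Lemma bil_int_ge0 (n : nat) (G : 'M[R]_n) :
  (forall z : 'I_n -> int, 0 <= bil G (\col_i (z i)%:~R) (\col_i (z i)%:~R)) ->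
  forall x, 0 <= bil G x x.
Proof.
move=> Gz x; rewrite leNgt; apply/negP => x0.
pose X := \sum_i `|x i 0|.
have xX i : `|x i 0| <= X by rewrite /X (bigD1 i) //= lerDl sumr_ge0.
have X0 : 0 <= X by apply: sumr_ge0.
pose K := \sum_i \sum_j `|G i j|.
have K0 : 0 <= K by apply: sumr_ge0 => i _; apply: sumr_ge0.
pose b := - bil G x x; have b0 : 0 < b by rewrite oppr_gt0.
pose N := (Num.bound ((2 * K * X + K) / b)).+1.
have Nb : 2 * K * X + K < N%:R * b.
  rewrite -ltr_pdivrMr //; apply: (lt_le_trans (archi_boundP _)).
    by rewrite divr_ge0 ?addr_ge0 ?mulr_ge0 // ltW.
  by rewrite ler_nat.
have N1 : 1 <= N%:R :> R by rewrite ler1n.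
pose z i := Num.floor (N%:R * x i 0).
pose e : 'cV[R]_n := \col_i (N%:R * x i 0 - (z i)%:~R).
have e1 i : `|e i 0| <= 1.
  have /andP[] := floor_itv (N%:R * x i 0); rewrite -/(z i) intrD => z1 z2.
  by rewrite mxE ger0_norm ?subr_ge0 // lerBlDl ltW.
have zE : \col_i (z i)%:~R = N%:R *: x + (- e) :> 'cV[R]_n.
  by apply/colP => i; rewrite !mxE; ring.
have := Gz z; rewrite zE !bilDl !bilDr !bilZl !bilZr !bilNl !bilNr.
have B1 := bil_entry_bound G xX e1; have B2 := bil_entry_bound G e1 xX.
have B3 := bil_entry_bound G e1 e1; rewrite -/K in B1 B2 B3.
move: B1 B2 B3; rewrite !ler_norml => /andP[B1 _] /andP[B2 _] /andP[_ B3].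
move: Nb; have -> : b = - bil G x x by [].
move: B1 B2 B3 N1; set NR : R := N%:R.
set bxx := bil G x x; set bxe := bil G x e; set bex := bil G e x; set bee := bil G e e.
move=> B1 B2 B3 N1 Nb le0.
have KX : 0 <= K * X by rewrite mulr_ge0.
have : NR * (2 * K * X + K) < NR * (NR * - bxx) by rewrite ltr_pM2l //; lra.
have : NR * - bxe <= NR * (K * X) by rewrite ler_wpM2l //; lra.
have : NR * - bex <= NR * (K * X) by rewrite ler_wpM2l //; lra.
have : K <= NR * K by rewrite ler_peMl.
by move: le0; lra.
Qed.


(** Magnitude and sign of each coordinate in units of the mesh; zero has two codes, which only
    enlarges the count. *)
Definition grid (r : nat) : finType := {ffun 'I_r -> 'I_(25 * r).+1 * bool}.

(* Mesh [1 / (4 sqrt r)]: rounding the coordinates moves a vector by at most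
   [1 / 4] in the Euclidean norm. *)
Definition grid_point (r : nat) (f : grid r) : 'cV[R]_r :=
  \col_i ((4 * Num.sqrt r%:R)^-1 * ((-1) ^+ (f i).2 * (f i).1%:R)).

(** The bound means Euclidean norm at most [5 / 4], enough for the rounding of the unit ball. *)
Definition net (r : nat) : {set grid r} :=
  [set f : grid r | (\sum_i (f i).1 ^ 2 <= 25 * r)%N]%SET.

Lemma sum_half_powers (N : nat) : \sum_(k < N) 2^-1 ^+ k <= 2 :> R.
Proof.
have : \sum_(k < N) 2^-1 ^+ k + 2 * 2^-1 ^+ N <= 2 :> R.
  elim: N => [|N IH]; first by rewrite big_ord0 expr0; lra.
  by rewrite big_ord_recr /= exprS; lra.
have : 0 <= 2^-1 ^+ N :> R by rewrite exprn_ge0 // invr_ge0.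
lra.
Qed.

(* Each grid point of the net is counted with the weight [2 ^- |z|_1], which is
   at least [2 ^- (25 r)] because [|z|_1 <= |z|_2 ^ 2] for integer vectors. *)
Lemma card_net (r : nat) : #|net r|%:R <= 2 ^+ (27 * r) :> R.
Proof.
have h0 : 0 <= 2^-1 :> R by rewrite invr_ge0.
have w0 (f : grid r) : 0 <= \prod_i 2^-1 ^+ (f i).1 :> R.
  by rewrite prodr_ge0 // => i _; rewrite exprn_ge0.
have wn (f : grid r) : f \in net r ->
    1 <= 2 ^+ (25 * r) * \prod_i 2^-1 ^+ (f i).1 :> R.
  rewrite inE => fn; rewrite prodrXr.
  have fl : (\sum_i (f i).1 <= 25 * r)%N.
    apply: leq_trans fn; apply: leq_sum => i _; rewrite expnS expn1.
    by case: (nat_of_ord _) => // k; rewrite leq_pmulr.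
  rewrite exprVn -ler_pdivrMr ?invr_gt0 ?exprn_gt0 // invrK mul1r.
  by rewrite ler_weXn2l // ler1n.
apply: (@le_trans _ _ (2 ^+ (25 * r) * \sum_(f : grid r) \prod_i 2^-1 ^+ (f i).1)).
  rewrite -sum1_card natr_sum mulr_sumr [leLHS]big_mkcond; apply: ler_sum => f _.
  by case: ifP => [/wn//|_]; rewrite mulr_ge0 ?exprn_ge0.
rewrite -(bigA_distr_bigA (fun (i : 'I_r) (kb : 'I_(25 * r).+1 * bool) => 2^-1 ^+ kb.1)).
rewrite (_ : 27 * r = 25 * r + 2 * r)%N; last by rewrite -mulnDl.
rewrite exprD ler_wpM2l ?exprn_ge0 // exprM.
(* Each coordinate contributes at most 4: two signs times a geometric sum at most 2. *)
rewrite -[r in leRHS]card_ord -prodr_const; apply: ler_prod => i _.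
apply/andP; split; first by apply: sumr_ge0 => k _; rewrite exprn_ge0.
rewrite -(pair_bigA _ (fun (k : 'I_(25 * r).+1) (_ : bool) => 2^-1 ^+ k)) /=.
under eq_bigr do rewrite big_bool /=.
rewrite big_split /= expr2.
have := sum_half_powers (25 * r).+1; lra.
Qed.

Lemma net_point_norm (r : nat) (f : grid r) : (0 < r)%N -> f \in net r ->
  bil 1%:M (grid_point f) (grid_point f) <= 25 / 16.
Proof.
move=> r0; rewrite inE => fn; rewrite bil1E.
have rR : 0 < r%:R :> R by rewrite ltr0n.
have -> : \sum_i grid_point f i 0 * grid_point f i 0 =
    (16 * r%:R)^-1 * (\sum_i (f i).1 ^ 2)%N%:R.
  rewrite natr_sum mulr_sumr; apply: eq_bigr => i _.
  rewrite mxE natrX -expr2 !exprMn sqrr_sign mul1r exprVn exprMn sqr_sqrtr //.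
  congr (_^-1 * _); ring.
rewrite mulrC ler_pdivrMr ?mulr_gt0 //.
apply: (@le_trans _ _ (25 * r)%N%:R); first by rewrite ler_nat.
rewrite natrM; lra.
Qed.

Lemma rounding (r : nat) (u : 'cV[R]_r) : (0 < r)%N -> bil 1%:M u u <= 1 ->
  exists2 f, f \in net r &
    bil 1%:M (u - grid_point f) (u - grid_point f) <= 16^-1.
Proof.
move=> r0 u1; have rR : 0 < r%:R :> R by rewrite ltr0n.
pose h : R := (4 * Num.sqrt r%:R)^-1.
have h0 : 0 < h by rewrite invr_gt0 mulr_gt0 // sqrtr_gt0.
have h2 : h ^+ 2 = (16 * r%:R)^-1.
  by rewrite /h exprVn exprMn sqr_sqrtr //; congr (_^-1); ring.
pose z i := Num.floor (u i 0 / h).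
have zu i : `|u i 0 - h * (z i)%:~R| <= h.
  have /andP[] := floor_itv (u i 0 / h); rewrite -/(z i) intrD.
  rewrite ler_pdivlMr // ltr_pdivrMr // => z1 z2.
  by rewrite ger0_norm; nra.
pose y : 'cV[R]_r := \col_i (h * (z i)%:~R).
have eb : bil 1%:M (u - y) (u - y) <= 16^-1.
  rewrite bil1E; apply: (@le_trans _ _ (\sum_(i < r) h ^+ 2)).
    apply: ler_sum => i _; rewrite !mxE -expr2 -[leLHS]real_normK ?num_real //.
    by rewrite lerXn2r ?nnegrE // ltW.
  have -> : \sum_(i < r) h ^+ 2 = r%:R * h ^+ 2 by rewrite sumr_const card_ord mulr_natl.
  by rewrite h2 invfM mulrCA mulfV ?mulr1 // gt_eqF.
have yb : bil 1%:M y y <= 25 / 16.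
  have [e eE] : exists e, e = u - y by exists (u - y).
  have yE : y = u - e by rewrite eE subKr.
  (* A substitute for the triangle inequality: [|u + 4 e| ^ 2 >= 0] bounds the cross term with the
     weights suited to [|e| = |u| / 4]. *)
  have := bil1_ge0 (u + 4 *: e).
  rewrite yE !(bilDl, bilDr, bilNl, bilNr, bilZl, bilZr).
  have -> : bil 1%:M e u = bil 1%:M u e by apply: bil_sym; rewrite trmx1.
  by move: u1 eb; rewrite -eE; lra.
have zb : (\sum_i `|z i|%N ^ 2 <= 25 * r)%N.
  rewrite -(ler_nat R) natr_sum natrM.
  have -> : \sum_i (`|z i|%N ^ 2)%:R = 16 * r%:R * bil 1%:M y y.
    rewrite bil1E mulr_sumr; apply: eq_bigr => i _; rewrite mxE.
    have -> : h * (z i)%:~R * (h * (z i)%:~R) = h ^+ 2 * (z i)%:~R ^+ 2 by ring.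
    rewrite h2 mulrA mulfV ?mul1r; last by rewrite mulf_neq0 ?gt_eqF.
    rewrite natrX; case: (z i) => k //.
    by rewrite NegzE mulrNz sqrrN abszN.
  have : 16 * r%:R * bil 1%:M y y <= 16 * r%:R * (25 / 16) by rewrite ler_wpM2l.
  lra.
have zle i : (`|z i|%N <= 25 * r)%N.
  apply: leq_trans zb; rewrite (bigD1 i) //=; apply: leq_trans (leq_addr _ _).
  by rewrite expnS expn1; case: absz => // k; rewrite leq_pmulr.
exists [ffun i => (inord `|z i|%N, z i < 0)].
  rewrite inE; apply: leq_trans zb; apply: leq_sum => i _.
  by rewrite ffunE /= inordK ?ltnS.
suff -> : grid_point [ffun i => (inord `|z i|%N, z i < 0)] = y by [].
apply/colP => i; rewrite !mxE ffunE /= inordK ?ltnS // -/h; congr (_ * _).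
case: (z i) => k /=; first by rewrite mul1r.
by rewrite expr1 mulN1r ?NegzE ?mulrNz.
Qed.

Lemma bil_le_homogeneous (n : nat) (G : 'M[R]_n) (lam : R) :
  (forall u, bil 1%:M u u = 1 -> bil G u u <= lam) ->
  forall u, bil G u u <= lam * bil 1%:M u u.
Proof.
move=> Gl u; have [/bil1_eq0 ->|u0] := eqVneq (bil 1%:M u u) 0.
  by rewrite -(scale0r 0) !bilZl !mul0r mulr0.
have up : 0 < bil 1%:M u u by rewrite lt_def u0 bil1_ge0.
pose a := (Num.sqrt (bil 1%:M u u))^-1.
have a2 : a * a = (bil 1%:M u u)^-1.
  by rewrite /a -invfM -expr2 sqr_sqrtr // ltW.
have := Gl (a *: u); rewrite !bilZl !bilZr !mulrA a2 mulVf // => /(_ erefl).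
by rewrite mulrC ler_pdivrMr.
Qed.

Lemma bil_homogeneous (r : nat) (G : 'M[R]_r) (lam : R) :
  (forall u, bil 1%:M u u <= 1 -> `|bil G u u| <= lam) ->
  forall u, `|bil G u u| <= lam * bil 1%:M u u.
Proof.
move=> Gl u; rewrite ler_norml lerNl.
have Nu v : - bil G v v = bil (0 *: G + (-1) *: G) v v.
  by rewrite bil_lincomb mul0r add0r mulN1r.
apply/andP; split; rewrite ?Nu; apply: bil_le_homogeneous => v v1.
  by rewrite -Nu (le_trans _ (Gl v _)) ?v1 // -normrN ler_norm.
by rewrite (le_trans (ler_norm _)) // Gl // v1.
Qed.

(* The supremum [lam] of the form over the unit ball satisfies
   [lam <= c + 9 / 16 lam]: rounding changes the form by [bil (u - y) (u + y)]. *)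
Lemma net_quadratic_bound (r : nat) (G : 'M[R]_r) (c : R) :
  (0 < r)%N -> G^T = G ->
  (forall f, f \in net r -> `|bil G (grid_point f) (grid_point f)| <= c) ->
  forall u, `|bil G u u| <= 16 / 7 * c * bil 1%:M u u.
Proof.
move=> r0 sG Gc.
pose A := [set `|bil G u u| | u in [set u | bil 1%:M u u <= 1]].
have A0 : A !=set0.
  by exists `|bil G 0 0|, 0 => //=; rewrite -(scale0r 0) bilZl mul0r.
have Aub : has_ubound A.
  exists ((\sum_i \sum_j `|G i j|) * (1 * 1)) => _ [u /= u1 <-].
  by apply: bil_entry_bound => i; apply: entry_le_bil1.
set lam := sup A.
have Al u : bil 1%:M u u <= 1 -> `|bil G u u| <= lam.
  by move=> u1; apply: ub_le_sup => //; exists u.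
have hl := bil_homogeneous Al.
have lamc : lam <= c + 9 / 16 * lam.
  apply: ge_sup => // _ [u /= u1 <-].
  have [f fn] := rounding r0 u1; have := Gc f fn.
  move: (grid_point f) => y yc eb.
  have [e eE] : exists e, e = u - y by exists (u - y).
  have [v vE] : exists v, v = u + y by exists (u + y).
  rewrite -eE in eb.
  have vb : bil 1%:M v v <= 81 / 16.
    have := bil1_ge0 (u + 4 *: e); have -> : v = 2 *: u - e.
      by rewrite vE eE scaler_nat mulr2n opprB addrACA subrr addr0 addrC.
    rewrite !(bilDl, bilDr, bilNl, bilNr, bilZl, bilZr).
    have -> : bil 1%:M e u = bil 1%:M u e by apply: bil_sym; rewrite trmx1.
    lra.
  have Bev : bil G u u - bil G y y = bil G e v.
    rewrite eE vE !(bilDl, bilDr, bilNl, bilNr) (bil_sym y u sG); ring.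
  (* Polarization: as [|e| <= 1 / 4] and [|v| <= 9 / 4], the scalings [3] and [1 / 3] make both
     norms at most [3 / 4], whence [9 / 16]. *)
  have p1 := hl (3 *: e + 3^-1 *: v); have p2 := hl (3 *: e - 3^-1 *: v).
  have lam0 : 0 <= lam.
    by apply: le_trans (Al 0 _) => //; rewrite -(scale0r 0) bilZl mul0r.
  have Bb : `|bil G e v| <= 9 / 16 * lam.
    move: p1 p2; rewrite !ler_norml !(bilDl, bilDr, bilNl, bilNr, bilZl, bilZr).
    rewrite (bil_sym v e sG).
    have -> : bil 1%:M v e = bil 1%:M e v by apply: bil_sym; rewrite trmx1.
    have : lam * bil 1%:M e e <= lam * 16^-1 by rewrite ler_wpM2l.
    have : lam * bil 1%:M v v <= lam * (81 / 16) by rewrite ler_wpM2l.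
    move=> h1 h2 /andP[q1 q2] /andP[q3 q4]; apply/andP; split; lra.
  have -> : bil G u u = bil G y y + bil G e v by rewrite -Bev; ring.
  by apply: le_trans (ler_normD _ _) _; apply: lerD.
move=> u; apply: le_trans (hl u) _; rewrite ler_wpM2r ?bil1_ge0 //; lra.
Qed.

End QuadraticForms.

(** * Existence of a compact singular value decomposition *)

Section SingularValues.
Variable R : realType.

Lemma bil_continuous (n : nat) (G : 'M[R]_n) :
  continuous (fun u : 'rV[R]_n => bil G u^T u^T).
Proof.
have -> : (fun u : 'rV[R]_n => bil G u^T u^T) =
    (fun u => \sum_i \sum_j (u 0 i * G i j) * u 0 j).
  apply/funext => u; rewrite bilE; apply: eq_bigr => i _.
  by apply: eq_bigr => j _; rewrite !mxE.
have addc : continuous (fun z : R * R => z.1 + z.2) by exact: add_continuous.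
apply: (continuous_big addc) => i _; apply: (continuous_big addc) => j _ u.
apply: cvgM; [exact: nbhs_filter| |exact: coord_continuous].
apply: cvgM; [exact: nbhs_filter|exact: coord_continuous|exact: cst_continuous].
Qed.

(** The unit sphere is closed in a cube, hence compact, and the form is continuous. *)
Lemma bil_max_unit (n : nat) (G : 'M[R]_n) : (0 < n)%N ->
  exists2 v : 'cV[R]_n, bil 1%:M v v = 1 &
    forall u, bil 1%:M u u = 1 -> bil G u u <= bil G v v.
Proof.
move=> n0; pose A := [set u : 'rV[R]_n | bil 1%:M u^T u^T = 1].
have A0 : A !=set0.
  exists (delta_mx 0 (Ordinal n0)); rewrite /A /= bil1E (bigD1 (Ordinal n0)) //=.
  rewrite !mxE !eqxx mulr1 big1 ?addr0 // => j /negPf jn.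
  by rewrite !mxE jn andbF mul0r.
have Ac : compact A.
  have cA : closed A.
    have /continuous_closedP := @bil_continuous n 1%:M.
    exact: (fun h => h [set 1 : R] (@closed_eq R 1)).
  apply: (subclosed_compact cA (rV_compact (fun=> @segment_compact R (-1) 1))).
  move=> u /= u1 i; have := @entry_le_bil1 R n u^T i.
  by rewrite u1 lexx mxE in_itv /= -ler_norml; apply.
have [c cA cmax] := compact_EVT_max A0 Ac
  (continuous_subspaceT (@bil_continuous n G)).
exists c^T; first by move: cA; rewrite inE.
by move=> u u1; rewrite -(trmxK u); apply: cmax; rewrite inE /A /= trmxK.
Qed.

(** With [w = H v], nonnegativity at [v + t w] reads [2 t |w| ^ 2 + t ^ 2 bil H w w >= 0], which
    fails for small negative [t] unless [w = 0]. *)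
Lemma psd_kernel (n : nat) (H : 'M[R]_n) (v : 'cV[R]_n) :
  H^T = H -> (forall u, 0 <= bil H u u) -> bil H v v = 0 -> H *m v = 0.
Proof.
move=> sH H0 Hv; pose w := H *m v.
have wv : bil H w v = bil 1%:M w w by rewrite /bil mulmx1 -mulmxA.
have vw : bil H v w = bil 1%:M w w by rewrite bil_sym.
apply: bil1_eq0; rewrite -/w.
have b0 := bil1_ge0 w; have c0 := H0 w.
set b := bil 1%:M w w in wv vw b0 *; set c := bil H w w in c0.
(* Adding 1 keeps the denominator positive when [c = 0]. *)
pose t := - b / (c + 1).
have := H0 (v + t *: w); rewrite !(bilDl, bilDr, bilZl, bilZr) Hv wv vw -/c.
have c1 : 0 < c + 1 by lra.
have tE : t * (c + 1) = - b by rewrite /t mulfVK // gt_eqF.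
move=> h; apply/eqP; rewrite eq_le b0 andbT leNgt; apply/negP => bp.
have : t < 0 by rewrite /t pmulr_llt0 ?invr_gt0 // oppr_lt0.
move=> t0; have : t * (2 * b + t * c) < 0.
  by rewrite nmulr_rlt0 //; nra.
by move: h; lra.
Qed.

(* A maximizer [v] of [|A v|] on the unit sphere works: with [lam] the maximum of
   [|A v| ^ 2], the form [lam - A^T A] is positive semidefinite and vanishes at [v]. *)
Lemma singular_pair (n d : nat) (A : 'M[R]_(n, d)) : A != 0 ->
  exists (s : R) (u : 'cV[R]_n) (v : 'cV[R]_d),
    [/\ 0 < s, u^T *m u = 1%:M, v^T *m v = 1%:M, A *m v = s *: u & A^T *m u = s *: v].
Proof.
move=> A0; have d0 : (0 < d)%N.
  by case: d A A0 => // A /eqP[]; apply/matrixP => i [].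
have [v v1 vmax] := bil_max_unit (A^T *m A) d0.
pose lam := bil (A^T *m A) v v.
have hl := bil_le_homogeneous vmax; rewrite -/lam in hl.
have GE u : bil (A^T *m A) u u = bil 1%:M (A *m u) (A *m u).
  by rewrite /bil mulmx1 trmx_mul !mulmxA.
have lam0 : 0 < lam.
  rewrite lt_neqAle {2}/lam GE bil1_ge0 andbT; apply: contra A0 => /eqP l0.
  have Au (u : 'cV[R]_d) : A *m u = 0.
    apply: bil1_eq0; apply/eqP; rewrite eq_le bil1_ge0 andbT -GE.
    by apply: le_trans (hl u) _; rewrite -l0 mul0r.
  apply/eqP/matrixP => i j; have /colP/(_ i) := Au (delta_mx j 0).
  by rewrite -colE !mxE.
have Gv : A^T *m A *m v = lam *: v.
  have : (lam%:M - A^T *m A) *m v = 0.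
    have bE u : bil (lam%:M - A^T *m A) u u = lam * bil 1%:M u u - bil (A^T *m A) u u.
      have E00 (M N : 'M[R]_1) : (lam *: M - N) 0 0 = lam * M 0 0 - N 0 0.
        by rewrite !mxE.
      by rewrite /bil -E00 mulmxBr mulmxBl mul_mx_scalar mulmx1 scalemxAl.
    apply: psd_kernel => [|u|].
    - by rewrite linearB /= tr_scalar_mx trmx_mul trmxK.
    - by rewrite bE subr_ge0.
    - by rewrite bE v1 mulr1 subrr.
  by rewrite mulmxBl mul_scalar_mx => /eqP; rewrite subr_eq0 => /eqP.
pose s := Num.sqrt lam; have s0 : 0 < s by rewrite sqrtr_gt0.
have s2 : s ^+ 2 = lam by rewrite sqr_sqrtr // ltW.
have mx11 p (x : 'cV[R]_p) : bil 1%:M x x = 1 -> x^T *m x = 1%:M.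
  by rewrite /bil mulmx1 => x1; rewrite [LHS]mx11_scalar x1.
exists s, (s^-1 *: (A *m v)), v; split => //.
- apply: mx11; rewrite bilZl bilZr -GE -/lam -s2; field; by rewrite gt_eqF.
- exact: mx11.
- by rewrite scalerA mulfV ?scale1r // gt_eqF.
- rewrite -scalemxAr mulmxA Gv scalerA -s2 expr2 mulrA mulVf ?mul1r // gt_eqF //.
Qed.

(** Deflation: the rest [A'] vanishes at [v] and its transpose at [u], so [u] and [v] are orthogonal
    to the factors of [A'] and extend them. *)
Lemma compact_svd_exists_rank (r n d : nat) (A : 'M[R]_(n, d)) : \rank A = r ->
  exists (U : 'M[R]_(n, r)) (sigma : 'rV[R]_r) (V : 'M[R]_(d, r)),
    compact_svd A U sigma V.
Proof.
elim: r A => [|r IH] A rA.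
  exists 0, 0, 0; split; [by apply/matrixP => -[]|by apply/matrixP => -[]|by case|].
  by move/eqP: rA; rewrite mxrank_eq0 => /eqP ->; rewrite !mul0mx.
have A0 : A != 0 by rewrite -mxrank_eq0 rA.
have [s [u [v [s0 uu vv Av Au]]]] := singular_pair A0.
pose A' := A - s *: (u *m v^T).
have A'v : A' *m v = 0.
  by rewrite mulmxBl Av -scalemxAl -mulmxA vv mulmx1 subrr.
have A'u : A'^T *m u = 0.
  rewrite linearB /= linearZ /= trmx_mul trmxK mulmxBl Au -scalemxAl -mulmxA uu.
  by rewrite mulmx1 subrr.
(* The row [v^T] lies in the row space of [A] but not in that of [A'], so the rank drops; a term of
   rank one cannot lower it further. *)
have rA' : \rank A' = r.
  have vA : (v^T <= A)%MS.
    apply/submxP; exists (s^-1 *: u^T).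
    have := congr1 trmx Au; rewrite trmx_mul trmxK linearZ /= => uA.
    by rewrite -scalemxAl uA scalerA mulVf ?scale1r // gt_eqF.
  have sA : (A' <= A)%MS.
    rewrite addmx_sub // -scaleNr scalemx_sub // (submx_trans (submxMl _ _)) //.
  have lt : (\rank A' < \rank A)%N.
    rewrite ltn_neqAle (mxrankS sA) andbT; apply/negP => /eqP e.
    have : (v^T <= A')%MS.
      by apply: submx_trans vA _; rewrite -(mxrank_leqif_sup sA) e.
    case/submxP => W vW; have := vv; rewrite vW -mulmxA A'v mulmx0 => /matrixP/(_ 0 0).
    by rewrite !mxE => /eqP; rewrite eq_sym oner_eq0.
  have le : (\rank A <= \rank A' + 1)%N.
    have -> : A = A' + s *: (u *m v^T) by rewrite subrK.
    apply: leq_trans (mxrank_add _ _) _; rewrite leq_add2l.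
    by rewrite scalemxAl (leq_trans (mxrankM_maxl _ _)) // rank_leq_col.
  by move: lt le; rewrite rA; lia.
have [U [sg [V [UU VV sg0 A'E]]]] := IH A' rA'.
have diag0 (x : 'cV[R]_r) : diag_mx sg *m x = 0 -> x = 0.
  move=> h; apply/colP => k; have /colP/(_ k) := h; rewrite mul_diag_mx !mxE.
  by move/eqP; rewrite mulf_eq0 gt_eqF ?sg0 //= => /eqP.
have Vv : V^T *m v = 0.
  apply: diag0; have := congr1 (mulmx U^T) A'v.
  by rewrite A'E -!mulmxA mulmx0 mulmxA UU mul1mx.
have Uu : U^T *m u = 0.
  apply: diag0; have := congr1 (mulmx V^T) A'u.
  by rewrite A'E !trmx_mul trmxK tr_diag_mx -!mulmxA mulmx0 mulmxA VV mul1mx.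
have tr0 p (W : 'M[R]_(p, r)) (w : 'cV[R]_p) : W^T *m w = 0 -> w^T *m W = 0.
  by move=> h; rewrite -[LHS]trmxK trmx_mul trmxK h trmx0.
have h1 : (row_mx u U)^T *m row_mx u U = 1%:M.
  by rewrite tr_row_mx mul_col_row uu UU Uu tr0 // -scalar_mx_block.
have h2 : (row_mx v V)^T *m row_mx v V = 1%:M.
  by rewrite tr_row_mx mul_col_row vv VV Vv tr0 // -scalar_mx_block.
have h3 (k : 'I_(1 + r)) : 0 < row_mx s%:M sg 0 k.
  rewrite mxE; case: split_ordP => j _; last exact: sg0.
  by rewrite ord1 mxE eqxx.
have h4 : A = row_mx u U *m diag_mx (row_mx s%:M sg) *m (row_mx v V)^T.
  rewrite diag_mx_row mul_row_block !mulmx0 addr0 add0r tr_row_mx mul_row_col.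
  rewrite -A'E.
  have -> : diag_mx s%:M = s%:M :> 'M[R]_1.
    by apply/matrixP => i j; rewrite !ord1 !mxE eqxx.
  by rewrite mul_mx_scalar -scalemxAl addrC subrK.
(* The blocks have [1 + r] columns, convertible with [r.+1]. *)
exact: (ex_intro _ _ (ex_intro _ _ (ex_intro _ _ (And4 h1 h2 h3 h4)))).
Qed.

Lemma compact_svd_exists (n d : nat) (A : 'M[R]_(n, d)) :
  exists (U : 'M[R]_(n, \rank A)) (sigma : 'rV[R]_(\rank A)) (V : 'M[R]_(d, \rank A)),
    compact_svd A U sigma V.
Proof. exact: compact_svd_exists_rank. Qed.

(** The default value of [xget] is excluded by [compact_svd_exists], so the coherence comes from an
    actual factor [U]. *)
Lemma coherence_svd (n d : nat) (A : 'M[R]_(n, d)) :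
  exists (U : 'M[R]_(n, \rank A)) (W : 'M[R]_(\rank A, d)),
    [/\ U^T *m U = 1%:M, A = U *m W & forall i, l2norm (row i U) <= coherence A].
Proof.
rewrite /coherence; case: xgetP => [c _ [U [sg [V [[UU VV _ AE] ->]]]]|h].
  exists U, (diag_mx sg *m V^T); split => [//||i]; first by rewrite mulmxA.
  exact: le_bigmax.
have [U [sg [V svd]]] := compact_svd_exists A.
have := h (\big[Num.max/0]_(i < n) l2norm (row i U)).
by case; exists U, sg, V.
Qed.

End SingularValues.

(** * Measurability and probability of the embedding event *)

Section Event.
Variable R : realType.

Lemma l2norm_mul_sqr (m n : nat) (B : 'M[R]_(m, n)) (x : 'cV[R]_n) :
  l2norm (B *m x) ^+ 2 = bil (B^T *m B) x x.
Proof. by rewrite l2norm_bil /bil mulmx1 trmx_mul !mulmxA. Qed.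

(** Both inequalities say that a quadratic form in [x] is nonnegative, so [bil_int_ge0] applies. *)
Lemma subspace_embedding_int (m n d : nat) (eps : R) (S : 'M[R]_(m, n))
    (A : 'M[R]_(n, d)) :
  (forall z : 'I_d -> int, let x := \col_i (z i)%:~R in
    (1 - eps) * l2norm (A *m x) ^+ 2 <= l2norm (S *m A *m x) ^+ 2 /\
    l2norm (S *m A *m x) ^+ 2 <= (1 + eps) * l2norm (A *m x) ^+ 2) ->
  subspace_embedding eps S A.
Proof.
move=> Hz x.
split.
  rewrite !l2norm_mul_sqr -subr_ge0 -[X in X - _]mul1r -mulNr -bil_lincomb.
  apply: bil_int_ge0 => z; have [h _] := Hz z.
  by rewrite bil_lincomb mul1r mulNr subr_ge0 -!l2norm_mul_sqr.
rewrite !l2norm_mul_sqr -subr_ge0 -[X in _ - X]mul1r -mulNr -bil_lincomb.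
apply: bil_int_ge0 => z; have [_ h] := Hz z.
by rewrite bil_lincomb mulNr mul1r subr_ge0 -!l2norm_mul_sqr.
Qed.

Lemma subspace_embedding_measurable (m n d : nat) (eps : R) (A : 'M[R]_(n, d))
    (dT : measure_display) (T : measurableType dT) (S : T -> 'M[R]_(m, n)) :
  (forall i j, measurable_fun setT (fun t => S t i j)) ->
  measurable [set t | subspace_embedding eps (S t) A].
Proof.
move=> mS.
pose x (z : {ffun 'I_d -> int}) : 'cV[R]_d := \col_i (z i)%:~R.
(* A countable intersection over integer vectors; numbers that encode none contribute [setT]. *)
pose F (k : nat) : set T := if unpickle k is Some z then
  [set t | (1 - eps) * l2norm (A *m x z) ^+ 2 <= l2norm (S t *m A *m x z) ^+ 2] `&`
  [set t | l2norm (S t *m A *m x z) ^+ 2 <= (1 + eps) * l2norm (A *m x z) ^+ 2]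
  else setT.
have -> : [set t | subspace_embedding eps (S t) A] = \bigcap_k F k.
  apply/seteqP; split => [t /= emb k _|t /= Ft].
    by rewrite /F; case: unpickle => // z; have [] := emb (x z).
  apply: subspace_embedding_int => z /=.
  have := Ft (pickle [ffun i => z i]) I; rewrite /F pickleK /=.
  suff -> : x [ffun i => z i] = \col_i (z i)%:~R by [].
  by apply/colP => i; rewrite !mxE ffunE.
have mN (v : 'cV[R]_n) : measurable_fun setT (fun t => l2norm (S t *m v) ^+ 2).
  under eq_fun do rewrite l2norm_sqr_col.
  apply: measurable_sum => i; apply: measurable_funX.
  under eq_fun do rewrite mxE.
  by apply: measurable_sum => j; apply: measurable_funM.
apply: bigcapT_measurable => k; rewrite /F; case: unpickle => // z.
apply: measurableI; rewrite -[X in measurable X]setTI; apply: measurable_fun_le => //.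
- by under eq_fun do rewrite -mulmxA; apply: mN.
- by under eq_fun do rewrite -mulmxA; apply: mN.
Qed.

(** The law gives the masses of single matrices, which add up over the finitely many matrices
    produced by samples satisfying [Q]. *)
Lemma s_hashing_event (m n s : nat) (dT : measure_display)
    (T : measurableType dT) (P : probability T R) (S : T -> 'M[R]_(m, n))
    (Q : 'M[R]_(m, n) -> Prop) :
  s_hashing P s S -> measurable [set t | Q (S t)] ->
  ((#|[set w : hashing_sample m n s | `[< Q (hashing_mx R w) >]]%SET|%:R
    / #|hashing_sample m n s|%:R)%:E <= P [set t | Q (S t)])%E.
Proof.
move=> [mS lawS] mQ.
pose G := [set w : hashing_sample m n s | `[< Q (hashing_mx R w) >]]%SET.
(* Distinct samples may give the same matrix, whose mass must be counted once. *)
pose r := undup [seq hashing_mx R w | w in G].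
have ur : uniq r by apply: undup_uniq.
have mM M : measurable [set t | S t = M].
  have -> : [set t | S t = M] =
      \bigcap_(i in [set` 'I_m]) \bigcap_(j in [set` 'I_n]) [set t | S t i j = M i j].
    apply/seteqP; split => [t /= <- i _ j _ //|t /= SM].
    by apply/matrixP => i j; apply: (SM i _ j).
  apply: fin_bigcap_measurable => // i _; apply: fin_bigcap_measurable => // j _.
  rewrite -[X in measurable X]setTI; exact: (mS i j measurableT [set M i j]).
have rQ M : M \in r -> Q M.
  rewrite mem_undup => /fintype.imageP[w wG eM]; rewrite eM.
  by move: wG; rewrite inE => /asboolP.
have sub : \bigcup_(M in [set` r]) [set t | S t = M] `<=` [set t | Q (S t)].
  by move=> t [M /= Mr ->]; apply: rQ.
have mU : measurable (\bigcup_(M in [set` r]) [set t | S t = M]).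
  by apply: fin_bigcup_measurable.
apply: le_trans (le_measure P _ _ sub); rewrite ?inE //.
rewrite measure_fin_bigcup; last 3 first.
- exact: finite_seq.
- by move=> M N _ _ [t [/= <- <-]].
- by move=> M _; apply: mM.
rewrite -fsbig_seq // (eq_bigr _ (fun M _ => lawS M)) sumEFin lee_fin.
rewrite -mulr_suml ler_wpM2r ?invr_ge0 // -natr_sum ler_nat.
have cardE M : #|[set w : hashing_sample m n s | hashing_mx R w == M]%SET| =
    (\sum_(w : hashing_sample m n s) (hashing_mx R w == M))%N.
  rewrite -sum1_card big_mkcond /=; apply: eq_bigr => w _.
  by rewrite inE; case: eqP.
rewrite (eq_bigr _ (fun M _ => cardE M)) exchange_big /= -/G -sum1_card big_mkcond /=.
apply: leq_sum => w _; case: ifP => // wG.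
have wr : hashing_mx R w \in r by rewrite mem_undup; apply: fintype.image_f.
by rewrite (big_rem _ wr) /= eqxx.
Qed.


End Event.

(** * Union bound over the net *)

Section Union.
Variable R : realType.

Lemma cauchy_schwarz (n : nat) (u v : 'cV[R]_n) :
  bil 1%:M u v ^+ 2 <= bil 1%:M u u * bil 1%:M v v.
Proof.
have [u0|u0] := eqVneq (bil 1%:M u u) 0.
  by rewrite u0 mul0r (bil1_eq0 u0) -(scale0r 0) bilZl mul0r expr0n.
have up : 0 < bil 1%:M u u by rewrite lt_def u0 bil1_ge0.
have vu : bil 1%:M v u = bil 1%:M u v by apply: bil_sym; rewrite trmx1.
have := bil1_ge0 (bil 1%:M u u *: v - bil 1%:M u v *: u).
rewrite !(bilDl, bilDr, bilNl, bilNr, bilZl, bilZr) vu.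
set a := bil _ u u in up *; set b := bil _ u v; set c := bil _ v v => h.
have : 0 <= a * (a * c - b ^+ 2) by move: h; lra.
by rewrite pmulr_rge0 // subr_ge0.
Qed.

Lemma mul_orthonormal_entry (n r : nat) (U : 'M[R]_(n, r)) (y : 'cV[R]_r) (nu : R) i :
  l2norm (row i U) <= nu -> bil 1%:M y y <= 1 -> `|(U *m y) i 0| <= nu.
Proof.
move=> Un y1; have nu0 : 0 <= nu by apply: le_trans Un; apply: sqrtr_ge0.
have -> : (U *m y) i 0 = bil 1%:M (row i U)^T y.
  by rewrite bil1E mxE; apply: eq_bigr => j _; rewrite !mxE.
suff : `|bil 1%:M (row i U)^T y| ^+ 2 <= nu ^+ 2.
  by rewrite ler_pXn2r // nnegrE.
rewrite real_normK ?num_real //; apply: le_trans (cauchy_schwarz _ _) _.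
have -> : bil 1%:M (row i U)^T (row i U)^T = l2norm (row i U) ^+ 2.
  by rewrite l2norm_sqr big_ord1 bil1E; apply: eq_bigr => j _; rewrite mxE expr2.
rewrite -[leRHS]mulr1 ler_pM ?sqr_ge0 ?bil1_ge0 //.
by rewrite lerXn2r ?nnegrE ?sqrtr_ge0.
Qed.

(** The factor [4 / 5] brings the net into the unit ball. Undoing it turns [eps / 4] into
    [25 / 64 eps], and [net_quadratic_bound] then gives [25 / 28 eps]. *)
Lemma embedding_of_net (m n d r : nat) (eps : R) (S : 'M[R]_(m, n))
    (A : 'M[R]_(n, d)) (U : 'M[R]_(n, r)) (W : 'M[R]_(r, d)) :
  (0 < r)%N -> 0 < eps -> U^T *m U = 1%:M -> A = U *m W ->
  (forall f, f \in net r -> let x := U *m ((4 / 5) *: grid_point R f) in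
     `|l2norm (S *m x) ^+ 2 - l2norm x ^+ 2| <= eps / 4) ->
  subspace_embedding eps S A.
Proof.
move=> r0 eps0 UU -> Hnet x.
pose G := 1 *: ((S *m U)^T *m (S *m U)) + (-1) *: (1%:M : 'M[R]_r).
have GE (y : 'cV[R]_r) :
    l2norm (S *m (U *m y)) ^+ 2 - l2norm (U *m y) ^+ 2 = bil G y y.
  by rewrite bil_lincomb mul1r mulN1r -UU -!l2norm_mul_sqr mulmxA.
have sG : G^T = G.
  by rewrite /G linearD !linearZ /= trmx_mul trmxK trmx1.
have Gnet f : f \in net r ->
    `|bil G (grid_point R f) (grid_point R f)| <= 25 / 64 * eps.
  move=> fn; have /= := Hnet f fn; rewrite GE bilZl bilZr mulrA normrM.
  by rewrite ger0_norm; lra.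
have := net_quadratic_bound r0 sG Gnet (W *m x); rewrite -GE -l2norm_bil.
have -> : l2norm (W *m x) ^+ 2 = l2norm (U *m W *m x) ^+ 2.
  by rewrite -(mulmxA U) [RHS]l2norm_mul_sqr UU l2norm_bil.
rewrite !mulmxA; set a := l2norm _ ^+ 2; set b := l2norm _ ^+ 2.
have b0 : 0 <= b by apply: sqr_ge0.
have eb : 0 <= eps * b by rewrite mulr_ge0 // ltW.
by rewrite ler_norml => /andP[h1 h2]; split; lra.
Qed.

Lemma card_hashing_sample_gt0 (m n s : nat) :
  (s <= m)%N -> (0 < #|hashing_sample m n s|)%N.
Proof.
move=> sm; apply/card_gt0P.
have inj : injectiveb [ffun k : 'I_s => widen_ord sm k].
  apply/injectiveP => k l; rewrite !ffunE => /(congr1 val) /= kl.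
  exact: val_inj.
pose f : injection m s :=
  exist (fun g : {ffun 'I_s -> 'I_m} => injectiveb g) _ inj.
by exists ([ffun=> (f, [ffun=> true])] : {ffun 'I_n -> injection m s * {ffun 'I_s -> bool}}).
Qed.

Lemma even_near (L : R) : 1 <= L ->
  exists p : nat, [/\ (0 < p)%N, ~~ odd p, 7 * L <= p%:R & p%:R <= 14 * L].
Proof.
move=> L1; have x0 : 0 <= 7 * L / 2 by lra.
have /andP[h1 h2] := truncn_itv x0; set k := Num.trunc _ in h1 h2.
(* The even number after [7 L / 2] is truncated and doubled; the upper bound uses [2 <= 7 L]. *)
exists k.+1.*2; split; first by rewrite doubleS.
- by rewrite odd_double.
- by rewrite -mul2n natrM; lra.
- by move: h1; rewrite -mul2n natrM -natr1; lra.
Qed.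

(** The [28 r] in [7 L] beats the [27 r] of the net size, as [2 <= e], and the logarithm in [7 L]
    leaves [delta]. *)
Lemma net_failure_le (r p : nat) (delta : R) : 0 < delta -> delta < 1 ->
  7 * log_dim r delta <= p%:R -> 2 ^+ (27 * r) * expR 1 ^- p <= delta.
Proof.
move=> d0 d1; rewrite /log_dim div1r lnV ?posrE // => Lp.
have ld : ln delta <= 0 by rewrite ln_le0 // ltW.
have -> : expR 1 ^- p = expR (- p%:R) :> R by rewrite -expRM_natr mul1r expRN.
have e2 : 2 ^+ (27 * r) <= expR (27 * r)%N%:R :> R.
  rewrite -[X in expR X]mul1r expRM_natr lerXn2r ?nnegrE ?(ltW (expR_gt0 _)) //.
  by apply: le_trans (expR_ge1Dx 1); lra.
apply: le_trans (ler_wpM2r (ltW (expR_gt0 _)) e2) _.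
rewrite -expRD -[leRHS]lnK ?posrE // ler_expR natrM.
have : 0 <= r%:R :> R by [].
move: Lp; lra.
Qed.

End Union.

Theorem theorem2p4p1 (R : realType) :
  exists C1 C2 C3 CM Cnu Cs : R,
    (0 < C1 /\ 0 < C2 /\ 0 < C3 /\ 0 < CM /\ 0 < Cnu /\ 0 < Cs) /\
    forall (r d n : nat), (0 < r)%N -> (r <= d)%N -> (d <= n)%N ->
    forall (eps delta : R) (m s : nat) (E : R),
      0 < eps -> eps < C3 ->
      0 < delta -> delta < C3 ->
      (0 < m)%N -> (0 < s)%N -> 0 < E ->
      1 <= s%:R :> R ->
      s%:R <= Cs * C2^-1 * eps^-1 * log_dim r delta ->
      CM <= E ->
      E <= C2 ^+ 2 * eps ^+ 2 * s%:R * (log_dim r delta)^-1 *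
           expR (Cs * (C2 * eps * s%:R)^-1 * log_dim r delta) ->
      Num.max (E * C2 ^- 2 * eps ^- 2 * log_dim r delta) (s%:R * expR 1)
        <= m%:R ->
    forall A : 'M[R]_(n, d),
      \rank A = r ->
      coherence A <= Num.sqrt s%:R * Cnu * C1^-1 * mu_bar C1 C2 E r eps delta ->
    forall (dT : measure_display) (T : measurableType dT)
           (P : probability T R) (S : T -> 'M[R]_(m, n)),
      s_hashing P s S ->
      ((1 - delta)%:E <= P [set t | subspace_embedding eps (S t) A])%E.
Proof.
(* All constants are 1 except the lower bound for [E] and the factor in the coherence bound, which
   are those of [tail_series_le]. *)
exists 1, 1, 1, (4 * tail_const R ^+ 4), (coherence_const R), 1.
have c1 := tail_const_ge1 R.
have c0 : 0 < tail_const R by lra.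
split.
  do ![split => //]; first by rewrite mulr_gt0 // exprn_gt0.
  by rewrite /coherence_const invr_gt0 mulr_gt0 // expR_gt0.
move=> r d n r0 rd dn eps delta m s E eps0 eps1 delta0 delta1 m0 s0 E0 _ _ EC _ mE.
move=> A rA cohA dT T P S hS; set L := log_dim r delta in mE cohA.
have L1 : 1 <= L.
  rewrite /L /log_dim div1r lnV ?posrE //.
  have : ln delta <= 0 by rewrite ln_le0 // ltW.
  have : 1 <= r%:R :> R by rewrite ler1n.
  lra.
have [p [p0 ep p7 p14]] := even_near L1.
have := mE; rewrite ge_max => /andP[mE1 mE2].
have sm : (s <= m)%N.
  rewrite -(ler_nat R); apply: le_trans mE2.
  by rewrite ler_peMr // -expR0 ler_expR.
have [U [W [UU AE Unu]]] := coherence_svd A.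
move: U W UU AE Unu; rewrite rA => U W UU AE Unu.
set nu := coherence A in Unu cohA.
have nu0 : 0 <= nu.
  have n0 : (0 < n)%N by apply: leq_trans dn; apply: leq_trans rd.
  by apply: le_trans (Unu (Ordinal n0)); apply: sqrtr_ge0.
pose x f : 'cV[R]_n := U *m ((4 / 5) *: grid_point R f).
have tail f : f \in net r ->
    #|[set w : hashing_sample m n s |
      eps / 4 < `|l2norm (hashing_mx R w *m x f) ^+ 2 - l2norm (x f) ^+ 2|]%SET|%:R
    <= #|hashing_sample m n s|%:R * expR 1 ^- p :> R.
  move=> fn; have y1 : bil 1%:M ((4 / 5) *: grid_point R f) ((4 / 5) *: grid_point R f) <= 1.
    by have := net_point_norm R r0 fn; rewrite bilZl bilZr; lra.
  apply: (hashing_tail (nu := nu)) => //.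
  - by rewrite divr_gt0.
  - by move=> j; apply: mul_orthonormal_entry.
  - by rewrite /x l2norm_mul_sqr UU.
  apply: (tail_series_le (L := L) (E := E)) => //; first lra.
    by move: mE1; rewrite expr1n invr1 mulr1.
  by move: cohA; rewrite /mu_bar invr1 mulr1 !mul1r sqrtr1 mul1r -/L.
pose Q (M : 'M[R]_(m, n)) := subspace_embedding eps M A.
have := s_hashing_event (Q := Q) hS (subspace_embedding_measurable eps A hS.1).
apply: le_trans; rewrite lee_fin.
have N0 : 0 < #|hashing_sample m n s|%:R :> R by rewrite ltr0n card_hashing_sample_gt0.
rewrite ler_pdivlMr // mulrBl mul1r lerBlDr -lerBlDl.
set good := [set w | _]%SET.
have -> : #|hashing_sample m n s|%:R - #|good|%:R = #|~: good|%:R :> R.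
  by rewrite -(cardsC good) natrD addrAC subrr add0r.
(* Union bound by counting: each bad sample exceeds the distortion [eps / 4] at some point of the
   net. *)
apply: (@le_trans _ _ (\sum_(f in net r) #|hashing_sample m n s|%:R * expR 1 ^- p)).
  apply: le_trans (ler_sum _ tail); rewrite -natr_sum ler_nat.
  under [leqRHS]eq_bigr do rewrite -sum1_card big_mkcond /=.
  rewrite exchange_big /= -sum1_card big_mkcond /=; apply: leq_sum => w _.
  case: ifP => // wbad.
  have [f fn bf] : exists2 f, f \in net r &
      eps / 4 < `|l2norm (hashing_mx R w *m x f) ^+ 2 - l2norm (x f) ^+ 2|.
    apply: contrapT => nobad; move: wbad; rewrite !inE => /negP; apply.
    apply/asboolP; apply: (embedding_of_net r0 eps0 UU AE) => f fn /=.
    by rewrite leNgt; apply/negP => bf; apply: nobad; exists f.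
  by rewrite (bigD1 f) //= inE bf.
rewrite sumr_const -[leLHS]mulr_natl mulrCA mulrC ler_wpM2r //.
apply: le_trans (net_failure_le delta0 delta1 p7).
by rewrite ler_wpM2r ?card_net // invr_ge0 exprn_ge0 // expR_ge0.
Qed.
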